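(* Let $\pi$ be an admissible combinatorial datum over an alphabet $\mathcal{A}$ and assume that the Rauzy class $\mathcal{R}$ of $\pi$ contains a cyclic combinatorial datum $\pi^{(\ast)}$. Let $(f_\tau)_{\tau\in\Delta^{\mathcal{A}}}$ be a full family over $\pi$. If $T\in\mathcal{T}(\pi,[0,1))$ is a Keane IET, then there exists $\tau\in\Delta^{\mathcal{A}}$ such that $f_\tau$ generates the same Rauzy path as $T$, that is $\gamma(f_\tau,\infty)=\gamma(T,\infty)$.
   Context: **GIETs.** An alphabet $\mathcal{A}$ is a finite set with $d\ge 2$ elements. A combinatorial datum over $\mathcal{A}$ is a pair $\pi=(\pi_t,\pi_b)$ of bijections $\mathcal{A}\to\{1,\dots,d\}$; it is admissible if $\pi_t^{-1}\{1,\dots,k\}\ne\pi_b^{-1}\{1,\dots,k\}$ for all $k=1,\dots,d-1$. A right-open interval is $I=[a,b)$ with $a<b$, and $\mathrm{Cl}(I)=[a,b]$. A generalized interval exchange transformation (GIET) on $I$ with datum $\pi$ is a bijection $f:I\to I$ considered together with two partitions $\{I^t_\alpha(f)\}_{\alpha\in\mathcal{A}}$ and $\{I^b_\alpha(f)\}_{\alpha\in\mathcal{A}}$ of $I$ into right-open subintervals, where $I^t_\alpha(f)$ (resp. $I^b_\alpha(f)$) is in position $\pi_t(\alpha)$ (resp. $\pi_b(\alpha)$) counting from the left, such that for every $\alpha$ the restriction $f_\alpha:=f|_{I^t_\alpha(f)}:I^t_\alpha(f)\to I^b_\alpha(f)$ (a continuous branch) is an orientation preserving homeomorphism. $\mathcal{G}(\pi,I)$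 is the set of these. The points $u^t_\alpha(f):=\inf I^t_\alpha(f)$ and $u^b_\alpha(f):=\inf I^b_\alpha(f)$ are the critical points and critical values of $f$. A GIET is an interval exchange transformation (IET) if all its branches are translations; $\mathcal{T}(\pi,I)\subset\mathcal{G}(\pi,I)$ is the set of IETs. The set $\mathcal{G}(\pi,I)$ has the metric $\mathrm{Dist}(f,f'):=\sum_{\alpha}\mathrm{Dist}_H(\overline{G_{f_\alpha}},\overline{G_{f'_\alpha}})$, where $\overline{G_{f_\alpha}}$ is the closure in $[\mathrm{Cl}(I)]^2$ of the graph of $f_\alpha$ and $\mathrm{Dist}_H$ is the Hausdorff distance induced by the Euclidean distance of $\mathbb{R}^2$. **Degenerations.** For $\mathcal{A}'\subset\mathcal{A}$ with $1\le|\mathcal{A}'|=d'\le d-1$, the reduction $\pi'$ of $\pi$ to $\mathcal{A}'$ is the pair of bijections $\pi'_\epsilon:\mathcal{A}'\to\{1,\dots,d'\}$, $\epsilon\in\{t,b\}$, obtained by composing $\pi_\epsilon|_{\mathcal{A}'}$ with the increasing bijection $\pi_\epsilon(\mathcal{A}')\to\{1,\dots,d'\}$ (here $d'=1$ is allowed, and GIETs with datum $\pi'$ are defined as before). A degeneration of a GIET in $\mathcal{G}(\pi,I)$, $I=[a,b)$, is $D=G_f\cup S$, where the regular part $G_f$ is the graph of some $f\in\mathcal{G}(\pi',I)$, $\pi'$ a reduction of $\pi$ to some $\mathcal{A}'=:\mathcal{A}(D)$, and the singular part $S=(s_\alpha)_{\alpha\in\mathcal{A}\setminus\mathcal{A}'}$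 is a family of points, labelled by $\mathcal{A}\setminus\mathcal{A}'$, in $(\{u^t_\alpha(f):\alpha\in\mathcal{A}'\}\cup\{b\})\times(\{u^b_\alpha(f):\alpha\in\mathcal{A}'\}\cup\{b\})$. Let $\widehat{\mathcal{G}}(\pi,I)$ be the union of $\mathcal{G}(\pi,I)$ and the set of all such degenerations (over all reductions); for $D=f\in\mathcal{G}(\pi,I)$ put $\mathcal{A}(D)=\mathcal{A}$, $S=\emptyset$. For $D\in\widehat{\mathcal{G}}(\pi,I)$ put $D_\alpha:=\overline{G_{f_\alpha}}$ if $\alpha\in\mathcal{A}(D)$ and $D_\alpha:=\{s_\alpha\}$ otherwise; the distance on $\widehat{\mathcal{G}}(\pi,I)$ is $\mathrm{Dist}(D,D'):=\sum_\alpha\mathrm{Dist}_H(D_\alpha,D'_\alpha)$. **Full families.** $\Delta^{\mathcal{A}}$ is the open standard simplex $\{\tau\in\mathbb{R}^{\mathcal{A}}:\tau_\alpha>0\ \forall\alpha,\ \sum_\alpha\tau_\alpha=1\}$ and $\overline{\Delta^{\mathcal{A}}}$ its closure. A full family over $\pi$ is a family $(f_\tau)_{\tau\in\Delta^{\mathcal{A}}}$, $f_\tau=F(\tau)$, given by a map $F:\Delta^{\mathcal{A}}\to\mathcal{G}(\pi,[0,1))$ such that: (1) $F$ is continuous; (2) $u^b_\alpha(f_\tau)=\sum_{\pi_b(\chi)\le\pi_b(\alpha)-1}\tau_\chi$ for all $\tau$ and all $\alpha\in\mathcal{A}$; (3) $F$ extends to a continuous map $\widehat F:\overline{\Delta^{\mathcal{A}}}\to\widehat{\mathcal{G}}(\pi,[0,1))$.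 **Rauzy classes and paths.** For an admissible $\pi$ let $\alpha_t,\alpha_b$ be the letters with $\pi_t(\alpha_t)=\pi_b(\alpha_b)=d$. The top operation $R^t$ (winner $\alpha_t$, loser $\alpha_b$) gives $\widetilde\pi=R^t(\pi)$ with $\widetilde\pi_t=\pi_t$ and $\widetilde\pi_b(\chi)=\pi_b(\chi)$ if $\pi_b(\chi)\le\pi_b(\alpha_t)$, $\widetilde\pi_b(\alpha_b)=\pi_b(\alpha_t)+1$, $\widetilde\pi_b(\chi)=\pi_b(\chi)+1$ if $\pi_b(\alpha_t)+1\le\pi_b(\chi)\le d-1$. The bottom operation $R^b$ (winner $\alpha_b$, loser $\alpha_t$) is the same with the roles of $t$ and $b$ exchanged. A Rauzy class $\mathcal{R}$ is a set of admissible data invariant under $R^t$ and $R^b$ and minimal with this property. An arrow is a pair $(\pi,\epsilon)$, $\pi\in\mathcal{R}$, $\epsilon\in\{t,b\}$, going from $\pi$ to $R^\epsilon(\pi)$; a Rauzy path is a concatenation of compatible arrows. A datum $\pi$ is cyclic if the permutation $\pi_b\circ\pi_t^{-1}$ of $\{1,\dots,d\}$ is a cycle of maximal order $d$. **Rauzy induction.** Let $\pi$ be admissible, $f\in\mathcal{G}(\pi,I)$, and assume the renormalizability condition $u^t_{\alpha_t}(f)\ne u^b_{\alpha_b}(f)$. Put $\epsilon(f)=t$ if $u^t_{\alpha_t}(f)<u^b_{\alpha_b}(f)$ and $\epsilon(f)=b$ if $u^t_{\alpha_t}(f)>u^b_{\alpha_b}(f)$. Let $\widetilde I\subset I$ be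 the right-open interval with $\inf\widetilde I=\inf I$, $\sup\widetilde I=\max\{u^t_{\alpha_t}(f),u^b_{\alpha_b}(f)\}$. Then $\mathcal{Q}(f):=\widetilde f$ is the first return map of $f$ to $\widetilde I$, an element of $\mathcal{G}(R^{\epsilon(f)}(\pi),\widetilde I)$, with labelled intervals: if $\epsilon(f)=t$, $I^t_\chi(\widetilde f)=I^t_\chi(f)$ for $\chi\ne\alpha_t$ and $I^t_{\alpha_t}(\widetilde f)=I^t_{\alpha_t}(f)\setminus I^b_{\alpha_b}(f)$; if $\epsilon(f)=b$, $I^t_\chi(\widetilde f)=I^t_\chi(f)$ for $\chi\ne\alpha_t,\alpha_b$, $I^t_{\alpha_t}(\widetilde f)=f^{-1}(I^t_{\alpha_t}(f))$ and $I^t_{\alpha_b}(\widetilde f)=I^t_{\alpha_b}(f)\setminus f^{-1}(I^t_{\alpha_t}(f))$; in both cases $I^b_\chi(\widetilde f)=\widetilde f(I^t_\chi(\widetilde f))$. Put $f^{(0)}=f$ and $f^{(k+1)}=\mathcal{Q}(f^{(k)})$ as long as $f^{(k)}$ satisfies the renormalizability condition; $\pi^{(k)}$ is the datum of $f^{(k)}$, and $\gamma_{k+1}$ is the arrow $(\pi^{(k)},\epsilon(f^{(k)}))$. The map $f$ is infinitely renormalizable if $f^{(k)}$ is defined and satisfies the renormalizability condition for every $k\in\mathbb{N}$ and moreover every letter $\alpha\in\mathcal{A}$ is the winner of $\gamma_k$ for infinitely many $k$. Its infinite Rauzy path is then $\gamma(f,\infty)=\gamma_1\ast\gamma_2\ast\cdots$.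 A Keane IET is an infinitely renormalizable IET; the conclusion $\gamma(f_\tau,\infty)=\gamma(T,\infty)$ includes that $f_\tau$ is infinitely renormalizable. *)

(* Defs.v *)
From HB Require Import structures.
From mathcomp Require Import all_boot all_order all_algebra all_fingroup.
From mathcomp Require Import all_classical all_reals all_analysis.

Set Implicit Arguments.
Unset Strict Implicit.
Unset Printing Implicit Defensive.

Import Order.TTheory GRing.Theory Num.Theory.
Import numFieldNormedType.Exports.

Local Open Scope classical_set_scope.
Local Open Scope ring_scope.

Inductive side := Top | Bot.

Definition other (e : side) : side := if e is Top then Bot else Top.

Section CombinatorialData.
Variable A : finType.

(* [pi e a] is the position of the letter a on side e, counted from 1.  The
   bijectivity of the positions is the separate predicate [is_datum]. *)
Definition datum := side -> A -> nat.

Definition is_datum (pi : datum) : Prop :=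
  forall e, set_bij [set: A] [set i | (1 <= i <= #|A|)%N] (pi e).

Definition admissible (pi : datum) : Prop :=
  forall k, (1 <= k <= #|A| - 1)%N ->
    pi Top @^-1` [set i | (1 <= i <= k)%N]
      <> pi Bot @^-1` [set i | (1 <= i <= k)%N].

(* Positions in {1, .., d} are shifted to the ordinals {0, .., d-1}, on which s
   is pi_b \o pi_t^-1; it is a d-cycle when its orbits have d elements. *)
Definition cyclic_datum (pi : datum) : Prop :=
  exists s : {perm 'I_#|A|},
    (forall (a : A) (i : 'I_#|A|), pi Top a = i.+1 -> pi Bot a = (s i).+1)
    /\ (forall i, #|porbit s i| = #|A|).

(* [Some] of the letter in the last position #|A| on side e; it is [None] only
   when pi is not a datum or A is empty. *)
Definition last_letter (pi : datum) (e : side) : option A :=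
  [pick a | pi e a == #|A|].

Definition rauzy_op (e : side) (pi : datum) : datum :=
  if (last_letter pi e, last_letter pi (other e)) is (Some w, Some l) then
    fun e' c =>
      match e, e' with
      | Top, Top | Bot, Bot => pi e' c
      | _, _ =>
        if (pi e' c <= pi e' w)%N then pi e' c
        else if c == l then (pi e' w).+1
        else (pi e' c).+1
      end
  else pi.

Definition rauzy_invariant (C : set datum) : Prop :=
  forall (pi : datum) (e : side), C pi -> C (rauzy_op e pi).

Definition rauzy_class (C : set datum) : Prop :=
  [/\ C !=set0,
      forall pi, C pi -> is_datum pi /\ admissible pi,
      rauzy_invariant C
    & forall C' : set datum,
        C' `<=` C -> C' !=set0 -> rauzy_invariant C' -> C' = C].

Definition arrow := (datum * side)%type.

Definition winner (g : arrow) : option A := last_letter g.1 g.2.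

(* Composing with the increasing bijection pi_e(B) -> {1, .., #|B|} amounts to
   taking the rank of a position among the positions of the letters of B. *)
Definition reduction (B : {set A}) (pi : datum) :
    side -> {x : A | x \in B} -> nat :=
  fun e a => #|[pred c : {x : A | x \in B} | (pi e (val c) <= pi e (val a))%N]|.

End CombinatorialData.

Definition right_open_itv (R : realType) (J : set R) : Prop :=
  exists a b : R, a < b /\ J = [set` `[a, b[].

Definition op_homeo (R : realType) (X Y : set R) (f : R -> R) : Prop :=
  [/\ set_bij X Y f,
      {within X, continuous f},
      exists g : R -> R,
        {within Y, continuous g} /\ (forall x, X x -> g (f x) = x)
    & forall x y, X x -> X y -> x < y -> f x < f y].

(* Raw data of a GIET on [glo, ghi[: the values of gmap outside of this interval
   are irrelevant, and [gint Top a], [gint Bot a] are the intervals I^t_a, I^b_a.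
   The axioms are in [is_giet]. *)
Record giet (R : realType) (A : finType) := Giet {
  gdatum : datum A;
  glo : R;
  ghi : R;
  gmap : R -> R;
  gint : side -> A -> set R }.

Section GIET.
Variables (R : realType) (A : finType).
Implicit Types (pi : datum A) (f : giet R A).

Definition gdom f : set R := [set` `[glo f, ghi f[].

Definition is_giet pi (a b : R) f : Prop :=
  [/\ is_datum pi /\ a < b,
      [/\ gdatum f = pi, glo f = a & ghi f = b],
      set_bij (gdom f) (gdom f) (gmap f),
      forall e : side,
        [/\ forall c, right_open_itv (gint f e c),
            trivIset [set: A] (gint f e),
            \bigcup_c gint f e c = gdom f
          & forall c c' x y, (pi e c < pi e c')%N ->
              gint f e c x -> gint f e c' y -> x < y]
    & forall c, op_homeo (gint f Top c) (gint f Bot c) (gmap f)].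

Definition is_iet pi (a b : R) f : Prop :=
  is_giet pi a b f /\
  forall c, exists t : R, forall x, gint f Top c x -> gmap f x = x + t.

(* critical points (side Top) and critical values (side Bot) *)
Definition gcrit f (e : side) (c : A) : R := inf (gint f e c).

Definition branch_graph f (c : A) : set (R * R) :=
  [set p | gint f Top c p.1 /\ p.2 = gmap f p.1].

End GIET.

Section Distance.
Variables (R : realType).

Definition eucl_dist (p q : R * R) : R :=
  Num.sqrt ((p.1 - q.1) ^+ 2 + (p.2 - q.2) ^+ 2).

Definition dist_to (Y : set (R * R)) (p : R * R) : R :=
  inf [set eucl_dist p q | q in Y].

Definition hausdorff_dist (X Y : set (R * R)) : R :=
  Num.max (sup [set dist_to Y p | p in X]) (sup [set dist_to X q | q in Y]).

Variable A : finType.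

Definition giet_dist (f f' : giet R A) : R :=
  \sum_(c : A) hausdorff_dist (closure (branch_graph f c))
                              (closure (branch_graph f' c)).

(* In [Degenerate B f s], f is a GIET over the alphabet B, and only the values
   of s at the letters outside of B are used. *)
Inductive ghat :=
  | Regular of giet R A
  | Degenerate (B : {set A}) of giet R {x : A | x \in B} & (A -> R * R).

Definition is_ghat (pi : datum A) (a b : R) (D : ghat) : Prop :=
  match D with
  | Regular f => is_giet pi a b f
  | Degenerate B f s =>
    [/\ (1 <= #|B| <= #|A| - 1)%N,
        is_giet (reduction pi) a b f
      & forall c, c \notin B ->
          (range (gcrit f Top) `|` [set b]) (s c).1 /\
          (range (gcrit f Bot) `|` [set b]) (s c).2]
  end.

Definition ghat_part (D : ghat) (c : A) : set (R * R) :=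
  match D with
  | Regular f => closure (branch_graph f c)
  | Degenerate B f s =>
    if insub c is Some c' then closure (branch_graph f c') else [set s c]
  end.

Definition ghat_dist (D D' : ghat) : R :=
  \sum_(c : A) hausdorff_dist (ghat_part D c) (ghat_part D' c).

End Distance.

Section FullFamily.
Variables (R : realType) (A : finType).

Definition open_simplex : set (A -> R) :=
  [set t | (forall c, 0 < t c) /\ \sum_(c : A) t c = 1].

Definition closed_simplex : set (A -> R) :=
  [set t | (forall c, 0 <= t c) /\ \sum_(c : A) t c = 1].

(* continuity on S for the sup distance on A -> R and the distance D on X *)
Definition continuous_on (S : set (A -> R)) (X : Type) (D : X -> X -> R)
    (F : (A -> R) -> X) : Prop :=
  forall t, S t -> forall eps : R, 0 < eps ->
    exists2 delta : R, 0 < delta &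
      forall t', S t' -> (forall c, `|t c - t' c| < delta) ->
        D (F t) (F t') < eps.

(* Only the values of F on the open simplex matter. *)
Definition full_family (pi : datum A) (F : (A -> R) -> giet R A) : Prop :=
  [/\ forall t, open_simplex t -> is_giet pi 0 1 (F t),
      continuous_on open_simplex (@giet_dist R A) F,
      forall t, open_simplex t -> forall c,
        gcrit (F t) Bot c = \sum_(x : A | (pi Bot x <= pi Bot c - 1)%N) t x
    & exists Fhat : (A -> R) -> ghat R A,
        [/\ forall t, closed_simplex t -> is_ghat pi 0 1 (Fhat t),
            forall t, open_simplex t -> Fhat t = Regular (F t)
          & continuous_on closed_simplex (@ghat_dist R A) Fhat]].

End FullFamily.

(* The fallback value x is used only when x never returns to J. *)
Definition first_return (R : realType) (J : set R) (f : R -> R) (x : R) : R :=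
  match pselect (exists n, (0 < n)%N && (iter n f x \in J)) with
  | left returns => iter (ex_minn returns) f x
  | right _ => x
  end.

Section RauzyInduction.
Variables (R : realType) (A : finType).
Implicit Types f : giet R A.

(* u^t_{alpha_t}(f) for e = Top and u^b_{alpha_b}(f) for e = Bot *)
Definition last_crit f (e : side) : R :=
  if last_letter (gdatum f) e is Some c then gcrit f e c else glo f.

Definition renormalizable f : Prop := last_crit f Top <> last_crit f Bot.

Definition rauzy_type f : side :=
  if last_crit f Top < last_crit f Bot then Top else Bot.

(* meaningful only when f is renormalizable *)
Definition rauzy_induction f : giet R A :=
  let pi := gdatum f in
  let hi := Num.max (last_crit f Top) (last_crit f Bot) in
  let g := first_return [set` `[glo f, hi[] (gmap f) in
  if (last_letter pi Top, last_letter pi Bot) is (Some at_, Some ab) then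
    let preim_at := gdom f `&` gmap f @^-1` gint f Top at_ in
    let It c :=
      match rauzy_type f with
      | Top => if c == at_ then gint f Top at_ `\` gint f Bot ab
               else gint f Top c
      | Bot => if c == at_ then preim_at
               else if c == ab then gint f Top ab `\` preim_at
               else gint f Top c
      end in
    Giet (rauzy_op (rauzy_type f) pi) (glo f) hi g
      (fun e c => if e is Top then It c else g @` It c)
  else f.

(* Arrows are numbered from 0: this is gamma_(k+1). *)
Definition rauzy_path f (k : nat) : arrow A :=
  let fk := iter k rauzy_induction f in (gdatum fk, rauzy_type fk).

Definition infinitely_renormalizable f : Prop :=
  (forall k, renormalizable (iter k rauzy_induction f)) /\
  (forall (c : A) (n : nat),
     exists2 k, (n <= k)%N & winner (rauzy_path f k) = Some c).

Definition keane_iet (pi : datum A) (a b : R) f : Prop :=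
  is_iet pi a b f /\ infinitely_renormalizable f.

End RauzyInduction.

(* Main.v *)
Require Import Defs.
From HB Require Import structures.
From mathcomp Require Import all_boot all_order all_algebra all_fingroup.
From mathcomp Require Import all_classical all_reals all_analysis.
From mathcomp Require Import lra zify.

(** A Rauzy path is a word of sides, one letter of the alphabet winning and one
    losing at each step, and the proof looks for a parameter that follows a
    given word in which every letter wins infinitely often.

    To each point of the closed simplex are attached branches: for every letter
    an increasing homeomorphism of the line, that maps a closed top interval
    onto a closed bottom interval, the two of them being possibly reduced to a
    point.  One step of Rauzy induction on a prescribed side with prescribed
    winner and loser cuts one interval in two and composes two branches
    ([rauzy_step]).  Stated so, it is defined everywhere, and the data obtained
    after any number of prescribed steps are continuous in the parameter up to
    the boundary of the simplex ([full_family_branches],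
    [rauzy_step_continuous]).  The step has its geometric meaning as soon as the
    loser does not protrude beyond the winner, which is a closed condition on
    the parameter ([weakly_follows]).

    The first n closed conditions can be satisfied together
    ([exists_weakly_following]).  Running the word backwards from intervals of
    length one gives an interval exchange J with integer lengths that follows
    it ([backward_lengths]).  A partition of [0, 1] into as many consecutive
    pieces, possibly empty, as J has unit intervals determines a parameter, of
    which the coordinates are the lengths of the bottom intervals of J; the
    inverse branches at this parameter pull the pieces back to a new partition.
    This is a continuous self-map of a simplex, and a fixed point of it is a
    monotone map that intertwines J with the branches at the corresponding
    parameter ([fixed_intertwines]), so that the inequalities satisfied by J
    hold for that parameter too.  The fixed point comes from the theorem of
    Brouwer, which is derived from a parity argument in the style of Scarf
    ([exists_full_room], [simplex_fixed_point]).

    By compactness one parameter satisfies all the closed conditions, and then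
    none of its intervals is ever degenerate ([no_null]).  A degenerate letter
    remains so, hence the set of degenerate letters stabilises; from then on the
    loser is degenerate whenever the winner is.  When the winner changes, the
    former winner is the new loser, so that a nondegenerate winner is followed
    by nondegenerate winners only.  Some letter is nondegenerate at each stage
    and every letter wins infinitely often, so no letter is degenerate.
    Therefore the parameter is interior, all the inequalities are strict, and
    the Rauzy induction of the corresponding map is the prescribed one
    ([realizes_rauzy_induction]). *)

Set Implicit Arguments.
Unset Strict Implicit.
Unset Printing Implicit Defensive.

Import Order.TTheory GRing.Theory Num.Theory.
Import numFieldNormedType.Exports.

(** * Rooms, doors and labels *)

Section RoomsAndDoors.
Import mathcomp.boot.fintype mathcomp.boot.finset.
Local Open Scope nat_scope.
Variables (I V : finType) (r : I -> V -> nat).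
Hypothesis r_inj : forall i, injective (r i).

(** Each index of [I] ranks the points of [V]; dominance says that no point
    beats all of [X] in every ranking of [S]. Applied to a point of [X] it
    shows that this point is ranked last in [X] by some index of [S], whence
    #|X| <= #|S|. *)
Definition dominant (X : {set V}) (S : {set I}) : bool :=
  [forall y, [exists i in S, [forall x in X, r i y <= r i x]]].

(** The extreme case of dominance: the indices of [S] rank pairwise distinct
    points of [X] last. *)
Definition room (z : {set V} * {set I}) : bool :=
  dominant z.1 z.2 && (#|z.1| == #|z.2|).

Definition incident (d z : {set V} * {set I}) : bool :=
  (d.1 \subset z.1) && (z.2 \subset d.2).

Lemma dominantP (X : {set V}) (S : {set I}) :
  reflect (forall y, exists2 i, i \in S & forall x, x \in X -> r i y <= r i x)
          (dominant X S).
Proof.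
apply: (iffP forallP) => h y.
  by have /exists_inP[i iS /forall_inP hi] := h y; exists i.
by have [i iS hi] := h y; apply/exists_inP; exists i => //; apply/forall_inP.
Qed.

Lemma dominant_sub (X X' : {set V}) (S S' : {set I}) : X \subset X' -> S' \subset S ->
  dominant X' S' -> dominant X S.
Proof.
move=> /subsetP sX /subsetP sS /dominantP h; apply/dominantP => y.
by have [i /sS iS hi] := h y; exists i => // x /sX; apply: hi.
Qed.

Section Minima.
Variables (X : {set V}) (x0 : V).
Hypothesis x0X : x0 \in X.

Definition rank_min i : V := [arg min_(x < x0 in X) r i x].

Lemma rank_min_in i : rank_min i \in X.
Proof. by rewrite /rank_min; case: arg_minnP. Qed.

Lemma rank_min_le i x : x \in X -> r i (rank_min i) <= r i x.
Proof. by rewrite /rank_min; case: arg_minnP => // y _ h; exact: h. Qed.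

Lemma rank_min_uniq i x : x \in X -> (forall y, y \in X -> r i x <= r i y) ->
  x = rank_min i.
Proof.
move=> xX h; apply: (@r_inj i); apply/eqP.
by rewrite eqn_leq rank_min_le // h // rank_min_in.
Qed.

Lemma dominant_min (S : {set I}) :
  dominant X S <-> forall y, exists2 i, i \in S & r i y <= r i (rank_min i).
Proof.
split=> [/dominantP h y|h].
  by have [i iS hi] := h y; exists i => //; apply: hi; exact: rank_min_in.
apply/dominantP => y; have [i iS hi] := h y; exists i => // x xX.
exact: leq_trans hi (rank_min_le _ xX).
Qed.

Lemma dominant_imset (S : {set I}) : dominant X S -> rank_min @: S = X.
Proof.
move=> /dominantP h; apply/setP => x; apply/imsetP/idP => [[i _ ->]|xX].
  exact: rank_min_in.
by have [i iS hi] := h x; exists i => //; apply: rank_min_uniq.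
Qed.

End Minima.

Section DoorTwoRooms.
Variables (X : {set V}) (S : {set I}) (x0 : V).
Hypotheses (x0X : x0 \in X) (dom : dominant X S) (cSX : #|S| = #|X|.+1).
Let m := rank_min X x0.

(** The indices of [S] rank all the points of [X] last, and there is one index
    too many, so exactly two of them choose the same point. *)
Lemma min_collision : exists i j,
  [/\ i \in S, j \in S, i != j, m i = m j
    & forall k, k \in S -> {in S :\ k &, injective m} -> k = i \/ k = j].
Proof.
have : ~~ (#|m @: S| == #|S|).
  by rewrite dominant_imset // cSX neq_ltn ltnSn.
move=> /imset_injP ninj.
have [i [j [iS jS ij mij]]] :
    exists i j, [/\ i \in S, j \in S, i != j & m i = m j].
  have /existsP[i /existsP[j /and4P[]]] : [exists i, [exists j,
      [&& i \in S, j \in S, i != j & m i == m j]]].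
    apply: contra_notT ninj; rewrite negb_exists => /forallP h i j iS jS mij.
    apply/eqP; move: (h i); rewrite negb_exists => /forallP /(_ j).
    by rewrite iS jS mij eqxx andbT /= negbK.
  by move=> *; exists i, j; split=> //; apply/eqP.
exists i, j; split=> // k kS kinj.
have [->|ki] := eqVneq k i; first by left.
have [->|kj] := eqVneq k j; first by right.
by move: ij; rewrite (kinj i j) ?eqxx // !inE eq_sym ?ki ?kj.
Qed.

(** The points that could replace, for the index [k], the point of [X] that
    [k] ranks last. *)
Definition above k : {set V} :=
  [set y | [forall i in S :\ k, r i (m i) < r i y]].

Lemma aboveP k y :
  reflect (forall i, i \in S -> i != k -> r i (m i) < r i y) (y \in above k).
Proof.
rewrite inE; apply: (iffP forall_inP) => h i.
  by move=> iS ik; apply: h; rewrite !inE ik.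
by rewrite !inE => /andP[ik iS]; apply: h.
Qed.

(** A room behind the door [(X, S)] is reached by giving up one index [k] of
    the colliding pair: either [k] is dropped, or, when this destroys
    dominance, [k] receives the best available new point. *)
Definition opposite_room k : {set V} * {set I} :=
  if [pick y in above k] is Some y then
    ([arg max_(x > y in above k) r k x] |: X, S) else (X, S :\ k).

Lemma above_le k y : y \in above k -> r k y <= r k (m k).
Proof.
move=> /aboveP h; have /(dominant_min x0X) /(_ y)[i iS hi] := dom.
have [<-//|ik] := eqVneq i k.
by move: (h i iS ik); rewrite ltnNge hi.
Qed.

Lemma opposite_roomP k (i j : I) : i \in S -> j \in S -> i != j -> m i = m j ->
  k = i \/ k = j ->
  (above k = set0 /\ opposite_room k = (X, S :\ k)) \/
  exists x, [/\ x \in above k, x \notin X, forall y, y \in above k -> r k y <= r k x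
    & opposite_room k = (x |: X, S)].
Proof.
move=> iS jS ij mij kij; rewrite /opposite_room.
case: pickP => [y yk|h]; last by left; split=> //; apply/setP => y; rewrite h inE.
right; case: arg_maxnP => // x xk hx; exists x; split=> //.
apply/negP => xX.
have [b bS xb] : exists2 b, b \in S & x = m b.
  by move: xX; rewrite -(dominant_imset x0X dom) => /imsetP.
have [a aS [ak xa]] : exists2 a, a \in S & a != k /\ x = m a.
  have [bk|bk] := eqVneq b k; last by exists b.
  case: kij => kE; [exists j|exists i] => //; split.
  - by rewrite kE eq_sym.
  - by rewrite xb bk kE.
  - by rewrite kE.
  - by rewrite xb bk kE.
by move/aboveP: xk => /(_ a aS ak); rewrite xa ltnn.
Qed.

Lemma opposite_room_room k (i j : I) : i \in S -> j \in S -> i != j -> m i = m j ->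
  k = i \/ k = j ->
  room (opposite_room k) && incident (X, S) (opposite_room k).
Proof.
move=> iS jS ij mij kij.
have kS : k \in S by case: kij => ->.
have [[ak0 ->]|[x [xk xX hx ->]]] := opposite_roomP iS jS ij mij kij.
  rewrite /room /incident /= subxx subD1set !andbT.
  have -> : #|X| == #|S :\ k| by move: cSX; rewrite (cardsD1 k) kS add1n => -[->].
  rewrite andbT; apply/(dominant_min x0X) => y.
  have : y \notin above k by rewrite ak0 inE.
  rewrite inE negb_forall_in => /exists_inP[a aS]; rewrite -leqNgt => ha.
  by exists a.
rewrite /room /incident /= subxx subsetUr !andbT cardsU1 xX cSX add1n eqxx andbT.
apply/dominantP => y.
have [yk|yk] := boolP (y \in above k).
  exists k => // z; rewrite !inE => /orP[/eqP->|zX]; first exact: hx.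
  exact: leq_trans (above_le yk) (rank_min_le _ _ zX).
move: yk; rewrite inE negb_forall_in => /exists_inP[a].
rewrite !inE => /andP[ak aS]; rewrite -leqNgt => ha.
exists a => // z; rewrite !inE => /orP[/eqP->|zX].
  by apply: leq_trans ha _; apply: ltnW; move/aboveP: xk => /(_ a aS ak).
exact: leq_trans ha (rank_min_le _ _ zX).
Qed.

Lemma opposite_room_neq i j : i \in S -> j \in S -> i != j -> m i = m j ->
  opposite_room i != opposite_room j.
Proof.
move=> iS jS ij mij.
have [[_ ->]|[x [xk xX hx ->]]] := opposite_roomP iS jS ij mij (or_introl erefl);
have [[_ ->]|[y [yk yX hy ->]]] := opposite_roomP iS jS ij mij (or_intror erefl).
- apply/eqP => -[] /setP /(_ i); rewrite !inE eqxx /= ij /=.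
  by rewrite iS.
- by apply/eqP => -[] /setP /(_ y); rewrite !inE eqxx (negbTE yX).
- by apply/eqP => -[] /setP /(_ x); rewrite !inE eqxx (negbTE xX).
- apply/eqP => -[] /setP /(_ x); rewrite !inE eqxx (negbTE xX) orbF => /esym; rewrite orbF => /eqP xy.
  subst y; have /(dominant_min x0X) /(_ x)[a aS] := dom.
  rewrite leqNgt => /negP; apply.
  have [ai|ai] := eqVneq a i.
    by move/aboveP: yk; apply=> //; rewrite ai.
  by move/aboveP: xk; apply.
Qed.

(** A room behind the door is obtained by removing an index or by adding a
    point. In both cases the last-ranked points become distinct, which forces
    the index concerned to be one of the colliding pair. *)
Lemma incident_opposite i j z : i \in S -> j \in S -> i != j -> m i = m j ->
  (forall k, k \in S -> {in S :\ k &, injective m} -> k = i \/ k = j) ->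
  room z -> incident (X, S) z -> z = opposite_room i \/ z = opposite_room j.
Proof.
move=> iS jS ij mij hk; case: z => X' S' /andP[/= domz /eqP cz] /andP[/= sX sS].
suff [k kij ->] : exists2 k, k = i \/ k = j & (X', S') = opposite_room k.
  by case: kij => ->; [left|right].
have [XX|nXX] := boolP (X' \subset X).
  have EX : X' = X by apply/eqP; rewrite eqEsubset XX.
  subst X'.
  have /properP[_ [k kS kS']] : S' \proper S.
    by rewrite properEcard sS -cz cSX ltnSn.
  have ES : S' = S :\ k.
    apply/eqP; rewrite eqEcard -cz; apply/andP; split.
      apply/subsetP => a aS'; rewrite !inE (subsetP sS) // andbT.
      by apply: contraNneq kS' => <-.
    by move: cSX; rewrite (cardsD1 k) kS add1n => -[->].
  subst S'.
  have kij : k = i \/ k = j.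
    by apply: hk => //; apply/imset_injP; rewrite dominant_imset // cz.
  exists k => //.
  have [[_ ->]//|[x [xk _ _ _]]] := opposite_roomP iS jS ij mij kij.
  have /(dominant_min x0X) /(_ x)[a] := domz.
  rewrite !inE => /andP[ak aS]; move/aboveP: xk => /(_ a aS ak).
  by rewrite ltnNge => /negbTE->.
have /subsetPn[x xX' xX] := nXX.
have lX : #|X'| <= #|X|.+1 by rewrite cz -cSX subset_leq_card.
have EX : X' = x |: X.
  apply/eqP; rewrite eq_sym eqEcard cardsU1 xX add1n lX andbT.
  by rewrite subUset sub1set xX' sX.
have ES : S' = S.
  by apply/eqP; rewrite eqEcard sS -cz EX cardsU1 xX add1n cSX /=.
subst X' S'.
have x0X' : x0 \in x |: X by rewrite !inE x0X orbT.
pose m' := rank_min (x |: X) x0.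
have im' := dominant_imset x0X' domz.
have m'inj : {in S &, injective m'} by apply/imset_injP; rewrite im' cz.
have [k kS xk] : exists2 k, k \in S & x = m' k.
  by move: (setU11 x X); rewrite -im' => /imsetP.
have m'm a : a \in S -> a != k -> m' a = m a.
  move=> aS ak; apply: rank_min_uniq => //.
    have : m' a \in x |: X by exact: rank_min_in.
    rewrite !inE => /orP[/eqP|//]; rewrite xk => /(m'inj _ _ aS kS) E.
    by rewrite E eqxx in ak.
  by move=> y yX; apply: rank_min_le => //; rewrite !inE yX orbT.
have kij : k = i \/ k = j.
  apply: hk => // a b; rewrite !inE => /andP[ak aS] /andP[bk bS].
  by rewrite -!m'm //; apply: m'inj.
exists k => //.
have xab : x \in above k.
  apply/aboveP => a aS ak; rewrite -(m'm a aS ak) ltn_neqAle.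
  rewrite rank_min_le ?setU11 // andbT.
  apply: contra_neqN ak => /eqP /r_inj E.
  by apply: m'inj => //; rewrite -xk.
have [[a0 _]|[y [yk yX hy ->]]] := opposite_roomP iS jS ij mij kij.
  by move: xab; rewrite a0 inE.
congr (_ |: _, _); apply: (@r_inj k); apply/eqP; rewrite eqn_leq hy //=.
have /(dominant_min x0X') /(_ y)[a aS] := domz; rewrite -/m'.
have [->|ak] := eqVneq a k; first by rewrite -xk.
by rewrite m'm // leqNgt; move/aboveP: yk => /(_ a aS ak) ->.
Qed.

(** The two rooms correspond to the two colliding indices. *)
Lemma door_two_rooms :
  #|[set z | room z & incident (X, S) z]| = 2.
Proof.
have [i [j [iS jS ij mij hk]]] := min_collision.
suff -> : [set z | room z & incident (X, S) z]
    = [set opposite_room i; opposite_room j].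
  by rewrite cards2 opposite_room_neq.
apply/setP => z; rewrite !inE; apply/andP/orP => [[rz iz]|].
  by case: (incident_opposite iS jS ij mij hk rz iz) => ->; rewrite eqxx; [left|right].
have hi := opposite_room_room iS jS ij mij (or_introl erefl).
have hj := opposite_room_room iS jS ij mij (or_intror erefl).
by case=> /eqP->; apply/andP.
Qed.

End DoorTwoRooms.

(** The doors without points are the entrances of the building: the single
    room behind such a door consists of the best point for its index. *)
Lemma outer_door_one_room (y0 : V) (i : I) :
  #|[set z | room z & incident (set0, [set i]) z]| = 1.
Proof.
pose x := [arg max_(x > y0) r i x].
have hx y : r i y <= r i x.
  by rewrite /x; case: arg_maxnP => // z _ h; exact: h.
suff -> : [set z | room z & incident (set0, [set i]) z] = [set ([set x], [set i])].
  by rewrite cards1.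
apply/setP => -[X S]; rewrite !inE /room /incident /= sub0set /=.
apply/idP/eqP => [/andP[/andP[dm /eqP c] sS]|[-> ->]]; last first.
  rewrite !cards1 eqxx subxx !andbT; apply/dominantP => y.
  by exists i; rewrite ?inE // => z; rewrite inE => /eqP->.
have SE : S = [set i].
  apply/eqP; rewrite eqEsubset sS sub1set.
  by have /dominantP/(_ y0)[a aS _] := dm; move/subsetP: (sS) => /(_ a aS); rewrite inE => /eqP <-.
subst S; congr (_, _).
have /eqP/cards1P[z XE] : #|X| = 1 by rewrite c cards1.
subst X; congr [set _]; apply: (@r_inj i); apply/eqP; rewrite eqn_leq hx /=.
have /dominantP/(_ x)[a] := dm; rewrite inE => /eqP-> /(_ z); apply.
by rewrite inE.
Qed.

Section Labels.
Variables (lab : V -> I) (i0 : I).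

(** The labels of the points are exactly the indices of the door other than
    [i0], each of them once by the cardinality condition. *)
Definition good_door (d : {set V} * {set I}) : bool :=
  [&& lab @: d.1 == d.2 :\ i0, i0 \in d.2 & #|d.2| == #|d.1|.+1].

Definition full_room (z : {set V} * {set I}) : bool := lab @: z.1 == z.2.

Lemma good_door_inj (X : {set V}) (S : {set I}) : good_door (X, S) -> {in X &, injective lab}.
Proof.
move=> /and3P[/= /eqP E i0S /eqP c]; apply/imset_injP; rewrite E.
by move: c; rewrite (cardsD1 i0) i0S add1n => -[->].
Qed.

(** The cardinalities leave room for a single difference, an index or a point. *)
Lemma incident_card (X X' : {set V}) (S S' : {set I}) : X \subset X' -> S' \subset S ->
  #|X'| = #|S'| -> #|S| = #|X|.+1 ->
  (X = X' /\ exists2 k, k \notin S' & S = k |: S') \/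
  (S = S' /\ exists2 x, x \in X' & X = X' :\ x).
Proof.
move=> sX sS c c'.
have [XX|/subsetPn[x xX' xX]] := boolP (X' \subset X).
  left; have EX : X = X' by apply/eqP; rewrite eqEsubset XX sX.
  split=> //; have /properP[_ [k kS kS']] : S' \proper S.
    by rewrite properEcard sS -c c' EX ltnSn.
  exists k => //; apply/eqP; rewrite eq_sym eqEcard cardsU1 kS' -c add1n c' EX leqnn.
  by rewrite andbT subUset sub1set kS.
right; have : #|X| < #|X'|.
  by rewrite proper_card // properE sX; apply/subsetPn; exists x.
rewrite c => lt; split; first by apply/eqP; rewrite eq_sym eqEcard sS c'.
exists x => //; apply/eqP; rewrite eqEcard; apply/andP; split.
  apply/subsetP => y yX; rewrite !inE (subsetP sX) // andbT.
  by apply: contraNneq xX => <-.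
rewrite -ltnS -c'; have := subset_leq_card sS.
by rewrite -c (cardsD1 x X') xX' add1n.
Qed.

(** A full room has one good door: the point labelled [i0] is removed, or the
    index [i0] is added when it labels no point. In any other room with a good
    door, some point has a label outside of [S] or the same label as another
    point; adding that label to [S], or removing the other point, gives
    exactly one further good door. *)
Lemma room_good_doors z : room z ->
  odd #|[set d | good_door d & incident d z]| = full_room z.
Proof.
case: z => X S /andP[/= dm /eqP c]; rewrite /full_room /=.
have [/eqP F|nF] := boolP (lab @: X == S).
  have inj : {in X &, injective lab} by apply/imset_injP; rewrite F c.
  suff [d hd] : exists d, [set d | good_door d & incident d (X, S)] = [set d].
    by rewrite hd cards1.
  have [i0S|i0S] := boolP (i0 \in S).
    have [x xX i0E] : exists2 x, x \in X & i0 = lab x.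
      by move: i0S; rewrite -F => /imsetP.
    exists (X :\ x, S); apply/setP => -[X' S']; rewrite !inE.
    apply/idP/eqP => [/andP[]|[-> ->]].
      move=> /and3P[/= /eqP E i0S' /eqP c'] /andP[/= sX sS].
      have [[EX [k kS' ES]]|[ES [y yX EX]]] := incident_card sX sS c c'.
        subst X' S'; exfalso; have : i0 \in (k |: S) :\ i0 by rewrite -E F.
        by rewrite !inE eqxx.
      subst X' S'; congr (_ :\ _, _).
      apply: (inj _ _ yX xX) => //; apply/eqP; rewrite -i0E; apply: contraT => ne.
      have : lab y \in lab @: (X :\ y) by rewrite E !inE ne -F imset_f.
      by move=> /imsetP[u]; rewrite !inE => /andP[uy uX] /(inj _ _ yX uX) E'; rewrite E' eqxx in uy.
    rewrite /good_door /incident /= i0S subxx subD1set -c (cardsD1 x X) xX eqxx !andbT.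
    apply/eqP/setP => a; rewrite !inE -F; apply/imsetP/andP => [[u]|[ai]].
      rewrite !inE => /andP[ux uX] ->; split; last exact: imset_f. rewrite i0E.
      by apply: contraNneq ux => /(inj _ _ uX xX) ->.
    move=> /imsetP[u uX aE]; exists u => //; rewrite !inE uX andbT.
      by apply: contraNneq ai => ux; rewrite aE i0E ux.
  exists (X, i0 |: S); apply/setP => -[X' S']; rewrite !inE.
  apply/idP/eqP => [/andP[]|[-> ->]].
    move=> /and3P[/= /eqP E i0S' /eqP c'] /andP[/= sX sS].
    have [[EX [k kS' ES]]|[ES [y yX EX]]] := incident_card sX sS c c'.
      subst X' S'; congr (_, _ |: _).
      by move: i0S'; rewrite !inE (negbTE i0S) orbF => /eqP.
    by move: i0S i0S'; rewrite ES => /negbTE->.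
  rewrite /good_door /incident /= subxx subsetUr !inE eqxx /= cardsU1 i0S c eqxx !andbT.
  apply/eqP/setP => a; rewrite F !inE.
  by have [->|] //= := eqVneq a i0; rewrite (negbTE i0S).
have [/set0Pn[[X' S']]|/negPn/eqP->] :=
    boolP ([set d | good_door d & incident d (X, S)] != set0); last by rewrite cards0.
rewrite inE => /andP[/and3P[/= /eqP E i0S' /eqP c'] /andP[/= sX sS]].
have [x xX [i0S Ex]] :
    exists2 x, x \in X & i0 \in S /\ lab @: (X :\ x) = S :\ i0.
  have [[EX [k kS ES]]|[ES [y yX EX]]] := incident_card sX sS c c'; last first.
    by exists y => //; rewrite -EX E ES; move: i0S'; rewrite ES.
  subst X' S'.
  have [ki|ki] := eqVneq k i0.
    by move: nF; rewrite E ki setU1K ?eqxx // -ki.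
  have [x xX kE] : exists2 x, x \in X & k = lab x.
    have : k \in (k |: S) :\ i0 by rewrite !inE eqxx ki.
    by rewrite -E => /imsetP.
  have i0S : i0 \in S by move: i0S'; rewrite !inE eq_sym (negbTE ki).
  have inj : {in X &, injective lab}.
    apply/imset_injP; rewrite E; move: c'.
    by rewrite (cardsD1 i0) i0S' add1n => -[->].
  exists x => //; split=> //; apply/setP => a.
  have : (a \in lab @: X) = (a \in (k |: S) :\ i0) by rewrite E.
  rewrite !inE => aE; apply/imsetP/andP => [[u]|[ai aS]].
    rewrite !inE => /andP[ux uX] a_u; move: aE.
    rewrite a_u imset_f // kE => /esym/andP[-> /orP[/eqP/(inj _ _ uX xX) ux'|//]].
    by rewrite ux' eqxx in ux.
  move: aE; rewrite ai aS orbT => /imsetP[u uX a_u]; exists u => //.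
  rewrite !inE uX andbT; apply: contraNneq kS => ux.
  by rewrite kE -ux -a_u.
have cx : #|S| = #|X :\ x|.+1.
  by rewrite -c (cardsD1 x X) xX add1n.
suff [d [d' [dd' ->]]] : exists d d', d != d' /\
    [set d | good_door d & incident d (X, S)] = [set d; d'].
  by rewrite cards2 dd'.
have XE : X = x |: (X :\ x) by rewrite setD1K.
have labX : lab @: X = lab x |: (S :\ i0) by rewrite XE imsetU1 Ex.
have [lS|lS] := boolP (lab x \in S); last first.
  exists (X :\ x, S), (X, lab x |: S); split.
    by apply/eqP => -[] /setP /(_ x); rewrite !inE eqxx xX.
  apply/setP => -[X'' S'']; rewrite !inE; apply/andP/orP => [[]|].
    move=> /and3P[/= /eqP E2 i0S2 /eqP c2] /andP[/= sX2 sS2].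
    have [[EX [k kS ES]]|[ES [y yX EX]]] := incident_card sX2 sS2 c c2.
      right; subst X'' S''; rewrite xpair_eqE eqxx /=.
      have : lab x \in (k |: S) :\ i0 by rewrite -E2 imset_f.
      by rewrite !inE (negbTE lS) orbF => /andP[_ /eqP->].
    left; subst X'' S''; rewrite xpair_eqE eqxx andbT.
    suff -> : x = y by [].
    apply/eqP; apply: contraNT lS => xy.
    have : lab x \in lab @: (X :\ y) by rewrite imset_f // !inE xy.
    by rewrite E2 !inE => /andP[].
  case=> /eqP[-> ->]; rewrite /good_door /incident /=.
    by rewrite Ex i0S cx !eqxx subD1set subxx.
  rewrite subxx subsetUr !inE i0S orbT cardsU1 lS c add1n eqxx labX !andbT.
  split=> //; apply/eqP/setP => a; rewrite !inE.
  have [->|//] := eqVneq a (lab x); rewrite /= andbT; apply/esym.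
  by apply: contraNneq lS => ->.
have li : lab x != i0.
  apply: contraNneq nF => li; rewrite labX li; apply/eqP.
  by rewrite setD1K.
have : lab x \in S :\ i0 by rewrite !inE li lS.
rewrite -Ex => /imsetP[x']; rewrite !inE => /andP[x'x x'X] lx.
exists (X :\ x, S), (X :\ x', S); split.
  by apply/eqP => -[] /setP /(_ x); rewrite !inE eqxx xX eq_sym x'x.
have labX' : lab @: X = S :\ i0.
  by rewrite labX; apply/setP => a; rewrite !inE; case: eqVneq => [->|//]; rewrite li lS.
apply/setP => -[X'' S'']; rewrite !inE; apply/andP/orP => [[g2]|].
  have := g2 => /and3P[/= /eqP E2 i0S2 /eqP c2] /andP[/= sX2 sS2].
  have [[EX [k kS ES]]|[ES [y yX EX]]] := incident_card sX2 sS2 c c2.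
    subst X'' S''; have : k \in (k |: S) :\ i0.
      by rewrite !inE eqxx andbT; apply: contraNneq kS => ->.
    by rewrite -E2 labX' !inE (negbTE kS) andbF.
  subst X'' S''; rewrite !xpair_eqE eqxx !andbT.
  have inj := good_door_inj g2.
  have [->|yx] := eqVneq x y; first by left.
  have [->|yx'] := eqVneq x' y; first by right.
  have := inj x x'; rewrite !inE yx yx' xX x'X => /(_ isT isT lx) xx.
  by rewrite xx eqxx in x'x.
case=> /eqP[-> ->]; rewrite /good_door /incident /=.
  by rewrite Ex i0S cx !eqxx subD1set subxx.
rewrite i0S subD1set subxx -c (cardsD1 x' X) x'X eqxx !andbT; split=> //.
rewrite -labX'; apply/eqP/setP => a; apply/imsetP/imsetP => -[u].
  by rewrite !inE => /andP[_ uX] ->; exists u.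
move=> uX ->; have [->|ux] := eqVneq u x'; last by exists u; rewrite // !inE ux.
by exists x; rewrite ?lx // !inE eq_sym x'x.
Qed.

(** Every good door leads to two rooms, except the entrance labelled by [i0]. *)
Lemma door_rooms d (y0 : V) : good_door d ->
  odd #|[set z | room z & incident d z]| = (d == (set0, [set i0])).
Proof.
case: d => X S gd; have := gd => /and3P[/= /eqP E i0S /eqP c].
have [X0|/set0Pn[x0 x0X]] := eqVneq X set0.
  subst X; rewrite cards0 in c; have /eqP/cards1P[i SE] := c.
  have Si : S = [set i0] by move: i0S; rewrite SE inE => /eqP->.
  by rewrite Si outer_door_one_room ?eqxx.
rewrite xpair_eqE; have -> /= : (X == set0) = false.
  by apply/eqP => X0; rewrite X0 inE in x0X.
have [dm|ndm] := boolP (dominant X S).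
  by rewrite (door_two_rooms x0X dm c).
suff -> : [set z | room z & incident (X, S) z] = set0 by rewrite cards0.
apply/setP => -[X' S']; rewrite !inE; apply: contraNF ndm.
by move=> /andP[/andP[/= dm _] /andP[/= sX sS]]; exact: dominant_sub dm.
Qed.

Lemma odd_sum_card (T : finType) (P : pred T) (F : T -> nat) :
  odd (\sum_(x | P x) F x) = odd (\sum_(x | P x) odd (F x)).
Proof. by elim/big_rec2: _ => // x a b _; rewrite !oddD oddb => ->. Qed.

(** Double counting of the incidences between rooms and good doors: modulo 2
    the doors contribute one, for the entrance, and the rooms contribute their
    number of full rooms, which is therefore odd. *)
Theorem exists_full_room (y0 : V) : exists X S, [/\ S != set0, dominant X S & lab @: X = S].
Proof.
have cnt : \sum_(d | good_door d) #|[set z | room z & incident d z]|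
    = \sum_(z | room z) #|[set d | good_door d & incident d z]|.
  have E1 d : #|[set z | room z & incident d z]| = \sum_(z | room z) incident d z.
    by rewrite -sum1_card big_mkcond [RHS]big_mkcond; apply: eq_bigr => z _;
       rewrite inE; case: room; case: incident.
  have E2 z : #|[set d | good_door d & incident d z]| = \sum_(d | good_door d) incident d z.
    by rewrite -sum1_card big_mkcond [RHS]big_mkcond; apply: eq_bigr => d _;
       rewrite inE; case: good_door; case: incident.
  under eq_bigr do rewrite E1; under [RHS]eq_bigr do rewrite E2.
  exact: exchange_big.
move/(congr1 odd): cnt; rewrite odd_sum_card [in RHS]odd_sum_card.
have -> : odd (\sum_(d | good_door d) odd #|[set z | room z & incident d z]|).
  under eq_bigr => d gd do rewrite (door_rooms y0 gd).
  rewrite (bigD1 (set0, [set i0])) /=; last first.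
    by rewrite /good_door /= imset0 setDv eqxx inE eqxx cards1 cards0.
  by rewrite eqxx big1 // => d /andP[_ /negbTE->].
move=> /esym o; have [z /andP[rz fz]] : exists z, room z && full_room z.
  apply/existsP; apply: contraTT o; rewrite negb_exists => /forallP h.
  rewrite big1 // => z rz; rewrite (room_good_doors rz).
  by move: (h z); rewrite rz /= => /negbTE->.
case: z rz fz => X S /andP[/= dm _] /eqP F; exists X, S; split=> //.
have /dominantP/(_ y0)[i iS _] := dm.
by apply/set0Pn; exists i.
Qed.

End Labels.
End RoomsAndDoors.

Local Open Scope classical_set_scope.
Local Open Scope ring_scope.

(** * Limits and compactness on the simplex *)

Section NearIn.
Variables (R : realType) (I : finType).
Implicit Types (S : set (I -> R)) (t : I -> R).

(** Neighbourhoods of [t] relative to [S], for the sup distance, so that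
    continuity on a simplex is convergence along this filter. *)
Definition near_in S t : set_system (I -> R) :=
  [set P | exists2 delta : R, 0 < delta &
    forall t', S t' -> (forall c, `|t c - t' c| < delta) -> P t'].

Global Instance near_in_filter S t : Filter (near_in S t).
Proof.
split.
- by exists 1.
- move=> P Q [d d0 hP] [d' d'0 hQ]; exists (Num.min d d'); first by rewrite lt_min d0.
  move=> t' St' h; split; [apply: hP|apply: hQ] => // c; have := h c;
  by rewrite lt_min => /andP[].
- by move=> P Q sPQ [d d0 hP]; exists d => // t' St' h; apply/sPQ/hP.
Qed.

Lemma near_in_dom S t : near_in S t S.
Proof. by exists 1. Qed.

Lemma near_in_coord S t c : t' c @[t' --> near_in S t] --> t c.
Proof.
apply/cvgrPdist_lt => e e0; exists e => // t' _; exact.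
Qed.

Lemma cvg_near_in (T : Type) (F : set_system T) {FF : Filter F} (u : T -> I -> R) S t :
  F (u @^-1` S) -> (forall c, u x c @[x --> F] --> t c) -> u @ F `=>` near_in S t.
Proof.
move=> FS h P [d d0 hP].
have : F [set x | forall c, `|t c - u x c| < d].
  by apply: filter_forall => c; have /cvgrPdist_lt := h c; apply.
by move=> h'; near=> x; apply: hP; [near: x|move=> c; move: c; near: x].
Unshelve. all: by end_near. Qed.

Lemma closed_simplex_le1 t c : closed_simplex t -> 0 <= t c <= 1.
Proof.
move=> [t0 t1]; rewrite t0 -t1 (bigD1 c) //= lerDl sumr_ge0 //.
Qed.

(** Compactness of the closed simplex, from the compactness of the cube that
    contains it. *)
Lemma simplex_cluster (u : nat -> I -> R) : (forall n, closed_simplex (u n)) ->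
  exists2 t, closed_simplex t &
    forall P, near_in (@closed_simplex R I) t P -> forall n, exists2 m, (n <= m)%N & P (u m).
Proof.
move=> hu.
have cpt := @tychonoff I (fun=> R) (fun=> `[0, 1]%classic)
  (fun i => @segment_compact R 0 1).
have [|t [_ clt]] := cpt (u @ \oo) _.
  by exists 0 => // n _ /= i; rewrite in_itv /=; exact: closed_simplex_le1.
have near_u (d : R) n : 0 < d -> exists2 m, (n <= m)%N & forall c, `|t c - u m c| < d.
  move=> d0; have := clt [set u m | m in [set m | (n <= m)%N]]
    [set t' | forall c, `|t c - t' c| < d].
  case.
  - by exists n => // m /= nm; exists m.
  - apply: (@filter_forall _ I (fun c (t1 : I -> R) => `|t c - t1 c| < d) _ (nbhs_filter t)) => c.
    have hb : nbhs (t c : R) [set y : R | `|t c - y| < d].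
      by apply/nbhs_ballP; exists d.
    exact: (@proj_continuous I (fun=> R) c t _ hb).
  - by move=> _ [[m nm <-] h]; exists m.
exists t.
  split=> [c|].
    rewrite leNgt; apply/negP => tc.
    have [|m _ /(_ c)] := near_u (- t c) 0; first by rewrite oppr_gt0.
    have [/(_ c) um _] := hu m; rewrite distrC ger0_norm; last by lra.
    lra.
  apply/eqP; rewrite eq_sym -subr_eq0 -normr_eq0; apply: contraT => ne.
  have p0 : 0 < `|1 - \sum_c t c| by rewrite lt_def ne normr_ge0.
  have [|m _ h] := near_u (`|1 - \sum_c t c| / #|I|.+1%:R) 0.
    by rewrite divr_gt0 // ltr0n.
  have := hu m; move=> [_ u1].
  have : `|1 - \sum_c t c| <= #|I|%:R * (`|1 - \sum_c t c| / #|I|.+1%:R).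
    rewrite -{1}u1 -sumrB; apply: le_trans (ler_norm_sum _ _ _) _.
    have -> : #|I|%:R * (`|1 - \sum_c t c| / #|I|.+1%:R)
      = \sum_(c : I) (`|1 - \sum_c t c| / #|I|.+1%:R) by rewrite sumr_const mulr_natl.
    by apply: ler_sum => c _; rewrite distrC ltW.
  rewrite leNgt => /negP[]; rewrite mulrCA gtr_pMr //.
  by rewrite ltr_pdivrMr ?ltr0n // mul1r ltr_nat.
move=> P [d d0 hP] n; have [m nm h] := near_u d n d0.
by exists m => //; apply: hP => //; exact: hu.
Qed.

End NearIn.

(** * The fixed point theorem of Brouwer on a simplex *)

Section GridRooms.
Local Open Scope nat_scope.
Variables (I : finType) (M : nat).

(** The points of the simplex with coordinates in (1/M)Z, scaled by M. *)
Definition grid := {v : {ffun I -> 'I_M.+1} | \sum_i v i == M}.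

Definition coord (v : grid) (i : I) : nat := val v i.

(** Ranking by the [i]-th coordinate, the ties being broken by an enumeration
    of the grid. *)
Definition grid_rank (i : I) (v : grid) : nat := coord v i * #|{: grid}| + enum_rank v.

Lemma grid_rank_inj i : injective (grid_rank i).
Proof.
move=> u v E; apply: enum_rank_inj; apply: val_inj => /=.
have : grid_rank i u %% #|{: grid}| = grid_rank i v %% #|{: grid}| by rewrite E.
by rewrite /grid_rank !modnMDl !modn_small.
Qed.

Lemma grid_rank_le i u v : grid_rank i u <= grid_rank i v -> coord u i <= coord v i.
Proof.
have K0 : 0 < #|{: grid}| by apply/card_gt0P; exists u.
move=> /(leq_div2r #|{: grid}|).
by rewrite /grid_rank !divnMDl // !divn_small // !addn0.
Qed.

Lemma grid_make (f : I -> nat) : \sum_i f i = M -> exists v : grid, forall i, coord v i = f i.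
Proof.
move=> fM; have fi i : f i < M.+1.
  by rewrite ltnS -fM (bigD1 i) //= leq_addr.
have vM : \sum_i [ffun i => Ordinal (fi i)] i == M.
  by apply/eqP; rewrite -[RHS]fM; apply: eq_bigr => i _; rewrite ffunE.
by exists (Sub [ffun i => Ordinal (fi i)] vM) => i; rewrite /coord /= ffunE.
Qed.

(** In a full room [(X, S)] let [mu i] be the least [i]-th coordinate in [X].
    If the numbers [mu i + 1], for [i] in [S], had a sum at most [M], a grid
    point with these coordinates would contradict dominance. Hence the
    coordinates of the points of [X] lie within #|I| of [mu] on [S], and below
    #|I| outside of [S]. *)
Lemma grid_near_label (i0 : I) (lab : grid -> I) :
  exists a : grid, forall i, coord a i < #|I| \/
    exists x : grid, lab x = i /\
      forall j, coord a j < coord x j + #|I| /\ coord x j < coord a j + #|I|.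
Proof.
have [y0 _] := @grid_make (fun i => if i == i0 then M else 0)
  (etrans (esym (big_mkcond _ _)) (big_pred1_eq _ _ _)).
have [X [S [S0 dm labX]]] := exists_full_room grid_rank_inj lab i0 y0.
have [i1 i1S] := set0Pn _ S0.
have [a aX] : exists a, a \in X by move: i1S; rewrite -labX => /imsetP[a]; exists a.
pose mu i := coord [arg min_(x < a in X) coord x i] i.
have muP i x : x \in X -> mu i <= coord x i.
  by rewrite /mu; case: arg_minnP => // y _ h; exact: h.
have muX i : exists2 x, x \in X & coord x i = mu i.
  by rewrite /mu; case: arg_minnP => // y yX _; exists y.
have muM : M < \sum_(i in S) (mu i).+1.
  rewrite ltnNge; apply/negP => le.
  (* The coordinate i1 takes the excess, so that the sum is M. *)
  pose f i := if i == i1 then (mu i1).+1 + (M - \sum_(i in S) (mu i).+1)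
    else if i \in S then (mu i).+1 else 0.
  have fM : \sum_i f i = M.
    rewrite (bigD1 i1) //= {1}/f eqxx.
    have -> : \sum_(i | i != i1) f i = \sum_(i in S | i != i1) (mu i).+1.
      rewrite [RHS]big_mkcondl; apply: eq_bigr => i /negbTE ne.
      by rewrite /f ne.
    move: le; rewrite (bigD1 i1) //=; lia.
  have [y hy] := grid_make fM.
  have /dominantP/(_ y)[i iS hi] := dm; have [x xX xi] := muX i.
  have := grid_rank_le (hi x xX); rewrite xi hy /f.
  case: eqP => [->|_]; [by lia | by rewrite iS ltnn].
have SI : #|S| <= #|I| by exact: max_card.
have sumS x : x \in X -> \sum_(i in S) coord x i <= M.
  move=> _; rewrite -[leqRHS](eqP (valP x)) [leqRHS](bigID (mem S)) /=.
  exact: leq_addr.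
have upS x i : x \in X -> i \in S -> coord x i < mu i + #|I|.
  move=> xX iS; have := sumS x xX; move: muM.
  rewrite (bigD1 i) // [in X in _ -> X](bigD1 i) //=.
  have : \sum_(j in S | j != i) (mu j).+1 <= \sum_(j in S | j != i) coord x j + #|S|.-1.
    have -> : #|S|.-1 = \sum_(j in S | j != i) 1.
      by rewrite sum1dep_card (cardsD1 i) iS; apply: eq_card => j; rewrite !inE andbC.
    rewrite -big_split; apply: leq_sum => j _; rewrite /= addn1 ltnS; exact: muP.
  have : 0 < #|S| by rewrite card_gt0; apply/set0Pn; exists i.
  move: SI; move: #|S| #|I| (coord x i) (mu i) => s n xi m; lia.
have upN x i : x \in X -> i \notin S -> coord x i < #|I|.
  move=> xX iS; have : \sum_(j in S) coord x j + coord x i <= M.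
    rewrite -[leqRHS](eqP (valP x)) [leqRHS](bigID (mem S)) /=.
    by rewrite leq_add2l (bigD1 i) //= leq_addr.
  have : \sum_(j in S) (mu j).+1 <= \sum_(j in S) coord x j + #|S|.
    rewrite -sum1_card -big_split; apply: leq_sum => j _; rewrite /= addn1 ltnS; exact: muP.
  lia.
exists a => i; have [iS|iS] := boolP (i \in S); last by left; apply: upN.
right; have [x xX ix] : exists2 x, x \in X & i = lab x.
  by move: (iS); rewrite -labX => /imsetP.
exists x; split=> // j; have [jS|jS] := boolP (j \in S).
  by move: (upS x j xX jS) (upS a j aX jS) (muP j x xX) (muP j a aX); move: #|I|; lia.
by move: (upN x j xX jS) (upN a j aX jS); move: #|I|; lia.
Qed.

End GridRooms.

Section Brouwer.
Variables (R : realType) (I : finType) (i0 : I).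
Variable Phi : (I -> R) -> I -> R.
Let D := @closed_simplex R I.
Hypothesis Phi_simplex : forall t, D t -> D (Phi t).
Hypothesis Phi_cont : forall t c, D t -> Phi t' c @[t' --> near_in D t] --> Phi t c.

Lemma simplex_le_coord t u : D t -> D u -> exists i, t i <= u i.
Proof.
move=> [_ t1] [_ u1]; apply: contrapT => h.
have : \sum_i u i < \sum_i t i.
  apply: ltr_sum => [|i _]; first by apply/hasP; exists i0; rewrite ?mem_index_enum.
  by rewrite ltNge; apply/negP => h'; apply: h; exists i.
by rewrite t1 u1 ltxx.
Qed.

(** A grid point is labelled by a coordinate that [Phi] does not decrease.
    Every coordinate of [a] which is not small is then not decreased at some
    point close to [a]. *)
Lemma approximate_fixed_point (M : nat) : (0 < M)%N -> exists2 a, D a &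
  forall i, a i < #|I|%:R / M%:R \/
    exists2 x, D x & x i <= Phi x i /\ forall j, `|a j - x j| < #|I|%:R / M%:R.
Proof.
move=> M0; have M0' : 0 < M%:R :> R by rewrite ltr0n.
pose pt (v : grid I M) i : R := (coord v i)%:R / M%:R.
have ptD v : D (pt v).
  split=> [c|]; first by rewrite divr_ge0.
  by rewrite -mulr_suml -natr_sum (eqP (valP v)) divff ?gt_eqF.
have /choice[lab labP] : forall v, exists i, pt v i <= Phi (pt v) i.
  by move=> v; apply: simplex_le_coord => //; exact: Phi_simplex.
have [a ha] := grid_near_label i0 lab; exists (pt a) => // i.
have [ai|[x [xi hx]]] := ha i; first by left; rewrite /pt ltr_pM2r ?invr_gt0 // ltr_nat.
right; exists (pt x) => //; split; first by rewrite -xi.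
move=> j; rewrite /pt -mulrBl normrM [`|_^-1|]ger0_norm ?invr_ge0 ?ler0n //.
rewrite ltr_pM2r ?invr_gt0 // ltr_norml; have [h1 h2] := hx j.
by move: h1 h2; rewrite -!(ltr_nat R) !natrD; set u := _%:R; set w := _%:R; move: #|I|%:R => n; lra.
Qed.

(** At a cluster point of approximate fixed points no coordinate can decrease
    under [Phi], and the sum of the coordinates is constant. *)
Theorem simplex_fixed_point : exists2 t, D t & forall i, Phi t i = t i.
Proof.
have /choice[a ha] : forall n : nat, exists a, D a /\
  forall i, a i < #|I|%:R / n.+1%:R \/
    exists2 x, D x & x i <= Phi x i /\ forall j, `|a j - x j| < #|I|%:R / n.+1%:R.
  by move=> n; have [a aD h] := @approximate_fixed_point n.+1 isT; exists a.
have [t tD clt] := simplex_cluster (fun n => (ha n).1).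
exists t => //.
suff le i : t i <= Phi t i.
  have [_ t1] := tD; have [_ P1] := Phi_simplex tD.
  move=> i; apply/eqP; rewrite eq_sym eq_le le /=.
  have Et : t i + \sum_(j | j != i) t j = 1 by rewrite -t1 [RHS](bigD1 i).
  have EP : Phi t i + \sum_(j | j != i) Phi t j = 1 by rewrite -P1 [RHS](bigD1 i).
  have : \sum_(j | j != i) t j <= \sum_(j | j != i) Phi t j by exact: ler_sum.
  lra.
rewrite leNgt; apply/negP => lt.
have ti : 0 < t i by apply: le_lt_trans lt; have [P0 _] := Phi_simplex tD.
pose e := (t i - Phi t i) / 2.
have e0 : 0 < e by rewrite /e; lra.
have /cvgrPdist_lt/(_ e e0)[d d0 hd] := Phi_cont (c := i) tD.
(* Points within 2r of t still have their i-th coordinate decreased by Phi,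
   and i-th coordinate at least r. *)
pose r := Num.min (Num.min d e) (t i) / 2.
have r0 : 0 < r by rewrite /r divr_gt0 // !lt_min d0 e0 ti.
have [rd re rt] : [/\ r + r <= d, r + r <= e & r + r <= t i].
  by rewrite /r -splitr; split; rewrite !ge_min lexx ?orbT.
have [N Nr] : exists N, forall n, (N <= n)%N -> #|I|%:R / n.+1%:R < r.
  exists (Num.bound (#|I|%:R / r)) => n Nn.
  rewrite ltr_pdivrMr ?ltr0n // mulrC -ltr_pdivrMr //.
  apply: lt_le_trans (archi_boundP _) _; first by rewrite divr_ge0 // ltW.
  by rewrite ler_nat leqW.
have [|m Nm hm] := clt [set t' | forall j, `|t j - t' j| < r] _ N.
  by exists r.
have hi := hm i; have [aD /(_ i)[ai|[x xD [xi hx]]]] := ha m.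
  have := lt_trans ai (Nr m Nm); move: hi; rewrite ltr_norml => /andP[_ h1] h2; lra.
have near_x j : `|t j - x j| < r + r.
  by rewrite (le_lt_trans (ler_distD (a m j) _ _)) // ltrD // (lt_trans (hx j)) // Nr.
have := hd x xD (fun j => lt_le_trans (near_x j) rd).
have := near_x i; rewrite /= !ltr_norml => /andP[_ h1] /andP[h2 _].
by move: xi h1 h2 re; rewrite /e; lra.
Qed.

End Brouwer.

(** * Branches over a combinatorial datum and their Rauzy steps *)

Definition side_eqb (e e' : side) : bool :=
  match e, e' with Top, Top | Bot, Bot => true | _, _ => false end.

Lemma side_eqP : Equality.axiom side_eqb.
Proof. by move=> [] []; constructor. Qed.
HB.instance Definition _ := hasDecEq.Build side side_eqP.

Lemma otherK : involutive other.
Proof. by case. Qed.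

Lemma other_neq e : (other e == e) = false.
Proof. by case: e. Qed.

Lemma neq_other e e' : e' != e -> e' = other e.
Proof. by case: e e' => [] []. Qed.

Section Datum.
Variable A : finType.
Implicit Type pi : datum A.

Lemma datum_inj pi e : is_datum pi -> injective (pi e).
Proof. by move=> /(_ e)[_ inj _] x y; apply: inj; rewrite ?inE. Qed.

Lemma datum_range pi e c : is_datum pi -> (1 <= pi e c <= #|A|)%N.
Proof. by move=> /(_ e)[h _ _]; apply: (h c). Qed.

Lemma datum_surj pi e i : is_datum pi -> (1 <= i <= #|A|)%N -> exists c, pi e c = i.
Proof. by move=> /(_ e)[_ _ h] /h[c _ <-]; exists c. Qed.

Lemma last_letterP pi e c : last_letter pi e = Some c -> pi e c = #|A|.
Proof. by rewrite /last_letter; case: pickP => // x /eqP h [<-]. Qed.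

Lemma last_letter_some pi e c : is_datum pi -> pi e c = #|A| -> last_letter pi e = Some c.
Proof.
move=> pd h; rewrite /last_letter; case: pickP => [x /eqP hx|/(_ c)]; last by rewrite h eqxx.
by congr Some; apply: (datum_inj (e := e) pd); rewrite h.
Qed.

(** The two operations written at once, with [e] the side of the winner. *)
Lemma rauzy_opE pi e w l : last_letter pi e = Some w -> last_letter pi (other e) = Some l ->
  forall e' c, rauzy_op e pi e' c =
    if e' == e then pi e' c else
    if (pi e' c <= pi e' w)%N then pi e' c
    else if c == l then (pi e' w).+1 else (pi e' c).+1.
Proof. by rewrite /rauzy_op => -> -> [] c; case: e. Qed.

End Datum.

(** For a letter [c], the interval on the side [e] is bounded by [lft e c] and
    [rgt e c]; the map [brn e c] sends the interval on the side [e] to the one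
    on the other side. The order of the interval on either side is not
    recorded: it comes from a datum. The values lie in the reals for maps of
    the interval and in the integers for their combinatorial models. *)
Record branches (A : Type) (V : Type) := Branches {
  lft : side -> A -> V;
  rgt : side -> A -> V;
  brn : side -> A -> V -> V }.

Definition cut_point A V (e : side) (w l : A) (D : branches A V) : V :=
  brn D e w (lft D (other e) l).

(** The step with winner [w], last on the side [e], and loser [l], last on the
    other side. On the side [e] the winner keeps what precedes the interval of
    the loser. On the other side the interval of the winner is cut in two, and
    the right-hand piece goes to the loser, of which the branch is composed
    with that of the winner. The formulas are symmetric in the two sides
    because inverse branches are part of the data. *)
Definition rauzy_step (A : eqType) V (e : side) (w l : A) (D : branches A V) : branches A V :=
  {| lft e' c := if (e' != e) && (c == l) then cut_point e w l D else lft D e' c;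
     rgt e' c :=
       if c == w then if e' == e then lft D (other e) l else cut_point e w l D
       else if (e' != e) && (c == l) then rgt D e' w else rgt D e' c;
     brn e' c :=
       if c == l then
         if e' == e then brn D e w \o brn D e l
         else brn D (other e) l \o brn D (other e) w
       else brn D e' c |}.

Section Tilings.
Variables (A : finType) (V : realDomainType).
Implicit Types (pi : datum A) (D : branches A V).

(** The intervals on each side are consecutive in the order of the datum,
    start at 0, and end at the same point on the two sides; intervals of
    length zero are allowed. *)
Record tiled pi D : Prop := Tiled {
  tile_le : forall e c, lft D e c <= rgt D e c;
  tile_next : forall e c c', pi e c' = (pi e c).+1 -> rgt D e c = lft D e c';
  tile_first : forall e c, pi e c = 1%N -> lft D e c = 0;
  tile_last : forall e c c', pi e c = #|A| -> pi (other e) c' = #|A| ->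
    rgt D e c = rgt D (other e) c' }.

Record branched D : Prop := Branched {
  brn_le : forall e c, {homo brn D e c : x y / x <= y};
  brnK : forall e c, cancel (brn D e c) (brn D (other e) c);
  brn_lft : forall e c, brn D e c (lft D e c) = lft D (other e) c;
  brn_rgt : forall e c, brn D e c (rgt D e c) = rgt D (other e) c }.

Lemma brnK' D e c : branched D -> cancel (brn D (other e) c) (brn D e c).
Proof. by move=> h x; have := brnK h (other e) c x; rewrite otherK. Qed.

Lemma brn_le_mono D e c : branched D -> {mono brn D e c : x y / x <= y}.
Proof.
move=> h x y; apply/idP/idP => [xy|]; last exact: brn_le.
by rewrite -(brnK h e c x) -(brnK h e c y); exact: brn_le.
Qed.

Lemma brn_lt_mono D e c : branched D -> {mono brn D e c : x y / x < y}.
Proof. by move=> h; apply: leW_mono; exact: brn_le_mono. Qed.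

(** Consecutive intervals are determined by their lengths. *)
Lemma positions_lft_sum (rho : A -> nat) (p q : A -> V) : injective rho ->
  (forall i, (1 <= i <= #|A|)%N -> exists c, rho c = i) ->
  (forall c, (1 <= rho c <= #|A|)%N) ->
  (forall c c', rho c' = (rho c).+1 -> q c = p c') ->
  (forall c, rho c = 1%N -> p c = 0) ->
  forall c, p c = \sum_(x | (rho x < rho c)%N) (q x - p x).
Proof.
move=> inj surj rg nx fst c; move: {2}(rho c) (erefl (rho c)) => n.
elim: n c => [|n IHn] c cn; first by have := rg c; rewrite cn.
have [n0|n0] := posnP n.
  rewrite fst ?cn ?n0 // big_pred0 // => x; rewrite ltnS leqn0.
  by have := rg x; case: (rho x).
have [b bn] : exists b, rho b = n.
  by apply: surj; rewrite n0 /= -ltnS -cn ltnW // ltnS; have /andP[] := rg c.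
rewrite -(nx b) ?bn // (bigD1 b) ?cn ?bn //=.
rewrite (eq_bigl (fun x => (rho x < rho b)%N)) -?IHn // ?subrK // => x.
by rewrite ltnS bn ltn_neqAle andbC -bn (inj_eq inj).
Qed.

Lemma tile_sum pi D e c : is_datum pi -> tiled pi D ->
  lft D e c = \sum_(x | (pi e x < pi e c)%N) (rgt D e x - lft D e x).
Proof.
move=> pd h; apply: (positions_lft_sum (rho := pi e) (p := lft D e)).
- exact: datum_inj.
- by move=> i; apply: datum_surj.
- by move=> x; apply: datum_range.
- by move=> *; apply: (tile_next h).
- by move=> *; apply: (tile_first h).
Qed.

Lemma tile_order pi D e c c' : is_datum pi -> tiled pi D ->
  (pi e c < pi e c')%N -> rgt D e c <= lft D e c'.
Proof.
move=> pd h; move: {2}(pi e c') (erefl (pi e c')) => n.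
elim: n c' => [|n IHn] c' cn; rewrite cn // ltnS => le.
have [b bn] : exists b, pi e b = n.
  apply: datum_surj => //; have := datum_range e c pd; have := datum_range e c' pd.
  by rewrite cn => /andP[_ /ltnW ->] /andP[/leq_trans /(_ le) ->].
rewrite -(tile_next h (c := b)) ?bn //.
move: le; rewrite leq_eqVlt => /orP[/eqP E|lt].
  by have -> : c = b by apply: (datum_inj (e := e) pd); rewrite bn.
by apply: le_trans (tile_le h e b); apply: IHn => //; rewrite bn.
Qed.

Lemma tile_lft_ge0 pi D e c : is_datum pi -> tiled pi D -> 0 <= lft D e c.
Proof.
move=> pd h; rewrite (tile_sum _ _ pd h) sumr_ge0 // => x _.
by rewrite subr_ge0 (tile_le h).
Qed.

Lemma tile_rgt_le pi D e c w : is_datum pi -> tiled pi D -> pi e w = #|A| ->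
  rgt D e c <= rgt D e w.
Proof.
move=> pd h ew; have := datum_range e c pd => /andP[_]; rewrite -ew leq_eqVlt.
case/orP => [/eqP/(datum_inj pd)->//|/(tile_order pd h)/le_trans]; apply.
exact: (tile_le h).
Qed.

Lemma tile_cover pi D e w x : is_datum pi -> tiled pi D -> pi e w = #|A| ->
  0 <= x -> x < rgt D e w -> exists c, lft D e c <= x < rgt D e c.
Proof.
move=> pd h ew x0 xE.
have A0 : (0 < #|A|)%N by apply/card_gt0P; exists w.
have [c1 hc1] := datum_surj e pd (i := 1) A0.
have lc1 : lft D e c1 <= x by rewrite (tile_first h).
pose c := [arg max_(c > c1 | lft D e c <= x) pi e c].
have [lc mc] : lft D e c <= x /\ forall b, lft D e b <= x -> (pi e b <= pi e c)%N.
  by rewrite /c; case: arg_maxnP => // b lb mb; split.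
exists c; rewrite lc /=.
have := datum_range e c pd => /andP[_]; rewrite leq_eqVlt => /orP[/eqP E|lt].
  by have -> : c = w by apply: (datum_inj (e := e) pd); rewrite ew.
have [b hb] := datum_surj e pd (i := (pi e c).+1) lt.
rewrite (tile_next h hb) ltNge; apply/negP => /mc.
by rewrite hb ltnn.
Qed.

Section Step.
Variables (pi : datum A) (e : side) (w l : A) (D : branches A V).
Hypotheses (pd : is_datum pi) (win : last_letter pi e = Some w)
  (lose : last_letter pi (other e) = Some l) (wl : w != l).
Hypotheses (tD : tiled pi D) (bD : branched D).
Hypothesis le_wl : lft D e w <= lft D (other e) l.

Let ew : pi e w = #|A|. Proof. exact: last_letterP. Qed.
Let el : pi (other e) l = #|A|. Proof. exact: last_letterP. Qed.
Let lw : (l == w) = false. Proof. by rewrite eq_sym (negbTE wl). Qed.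

Lemma last_ends : rgt D e w = rgt D (other e) l.
Proof. exact: (tile_last tD). Qed.

Lemma lft_cut : lft D (other e) w <= cut_point e w l D.
Proof. by rewrite -(brn_lft bD) /cut_point (brn_le_mono _ _ bD). Qed.

Lemma cut_rgt : cut_point e w l D <= rgt D (other e) w.
Proof. by rewrite -(brn_rgt bD) /cut_point (brn_le_mono _ _ bD) last_ends (tile_le tD). Qed.

Lemma pos_w_lt : (pi (other e) w < #|A|)%N.
Proof.
have := datum_range (other e) w pd => /andP[_]; rewrite leq_eqVlt => /orP[/eqP E|//].
by move: wl; rewrite (datum_inj (e := other e) pd (x1 := w) (x2 := l)) ?eqxx // E.
Qed.

(** On the side of the loser the datum [rauzy_op e pi] inserts [l] just after
    [w], which is where the interval of [w] has been cut; the interval that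
    [l] occupied at the end is discarded, and this moves the common end to its
    left endpoint. *)
Lemma rauzy_step_tiled : tiled (rauzy_op e pi) (rauzy_step e w l D).
Proof.
have op := rauzy_opE win lose; have kd := pos_w_lt.
have lft1 c : pi (other e) c = 1%N -> c != l.
  move=> c1; apply: contraTneq kd => cl; rewrite -leqNgt -el -cl c1.
  by have /andP[] := datum_range (other e) w pd.
have last_e c : pi e c = #|A| -> c = w.
  by move=> h; apply: (datum_inj (e := e) pd); rewrite ew.
have nl c : (pi (other e) c <= pi (other e) w)%N -> c != l.
  by move=> le; apply: contraTneq kd => cl; rewrite -leqNgt -el -cl.
split=> /=.
- move=> e' c; have [->|/neq_other->] := eqVneq e' e; rewrite ?eqxx ?other_neq /=.
    have [->//|_] := eqVneq c w; exact: (tile_le tD).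
  have [->|_] := eqVneq c w; first by rewrite (negbTE wl) lft_cut.
  have [_|_] := eqVneq c l; first exact: cut_rgt.
  exact: (tile_le tD).
- move=> e' c c'; rewrite !op.
  have [->|/neq_other->] := eqVneq e' e; rewrite ?eqxx ?other_neq /=.
    move=> E; have -> : (c == w) = false.
      apply/eqP => cw; have /andP[_] := datum_range e c' pd.
      by rewrite E cw ew ltnn.
    exact: (tile_next tD).
  case: (leqP (pi (other e) c) (pi (other e) w)) => ck;
    case: (leqP (pi (other e) c') (pi (other e) w)) => c'k.
  - move=> E; rewrite (negbTE (nl _ ck)) (negbTE (nl _ c'k)).
    have -> : (c == w) = false.
      by apply/eqP => cw; move: c'k; rewrite E cw ltnn.
    exact: (tile_next tD).
  - case: (eqVneq c' l) => [_|c'l] [E]; last by move: c'k; rewrite E ltnNge ck.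
    have -> : c = w by apply: (datum_inj (e := other e) pd).
    by rewrite eqxx.
  - by case: (eqVneq c l) => cl E; move: c'k ck; rewrite E; lia.
  - have cw : (c == w) = false by apply/eqP => cw; move: ck; rewrite cw ltnn.
    rewrite cw; case: (eqVneq c l) => [cl|cl].
      by case: (eqVneq c' l) => [c'l E|c'l [E]]; [lia|exact: (tile_next tD)].
    by case: (eqVneq c' l) => [c'l [E]|c'l [E]]; [move: ck; lia|exact: (tile_next tD)].
- move=> e' c; rewrite op.
  have [->|/neq_other->] := eqVneq e' e; rewrite ?eqxx ?other_neq /=.
    exact: (tile_first tD).
  have := datum_range (other e) w pd => /andP[w1 _].
  case: ifP => [ck c1|/negbT ck].
    by rewrite (negbTE (lft1 _ c1)); apply: (tile_first tD).
  case: (eqVneq c l) => [cl E|cl [E]]; first by move: w1; lia.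
  by have := datum_range (other e) c pd; rewrite E.
- suff E' : forall e1 c, rauzy_op e pi e1 c = #|A| ->
      rgt (rauzy_step e w l D) e1 c = lft D (other e) l.
    by move=> e1 c c' h h'; exact: (etrans (E' _ _ h) (esym (E' _ _ h'))).
  move=> e1 c; rewrite op /=.
  have [->|/neq_other->] := eqVneq e1 e; rewrite ?eqxx ?other_neq /=.
    by move=> /last_e->; rewrite eqxx.
  case: ifP => [ck E|/negbT ck]; first by move: kd; rewrite ltnNge -E ck.
  have -> : (c == w) = false by apply/eqP => cw; move: ck; rewrite cw leqnn.
  case: (eqVneq c l) => [cl E|cl E]; apply: (tile_next tD); rewrite el -E //.
Qed.

Lemma rauzy_step_branched : branched (rauzy_step e w l D).
Proof.
split=> /=.
- move=> e' c x y xy; case: ifP => _; last exact: (brn_le bD).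
  by case: ifP => _ /=; do 2!apply: (brn_le bD).
- move=> e' c x; case: ifP => _; last exact: (brnK bD).
  have [->|/neq_other->] := eqVneq e' e; rewrite ?otherK ?eqxx ?other_neq /=.
    by rewrite (brnK bD) (brnK bD).
  by rewrite (brnK' _ _ bD) (brnK' _ _ bD).
- move=> e' c; have [->|/neq_other->] := eqVneq e' e; rewrite ?otherK ?eqxx ?other_neq /=.
    have [->|_] := eqVneq c l; last exact: (brn_lft bD).
    by rewrite /= (brn_lft bD).
  have [->|_] := eqVneq c l; last by rewrite (brn_lft bD) otherK.
  by rewrite /= /cut_point (brnK bD) (brn_lft bD) otherK.
- move=> e' c; have [->|/neq_other->] := eqVneq e' e; rewrite ?otherK ?eqxx ?other_neq /=.
    have [->|cl] := eqVneq c l; last by have [->|_] := eqVneq c w; rewrite ?(brn_rgt bD).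
    by rewrite lw /= (brn_rgt bD) -last_ends (brn_rgt bD).
  have [->|cl] := eqVneq c l.
    by rewrite lw /= (brn_rgt bD) otherK last_ends (brn_rgt bD) otherK.
  case: ifP => [/eqP->|_]; last by rewrite (brn_rgt bD) otherK.
  by rewrite (brnK bD).
Qed.

End Step.
End Tilings.

(** * Walks in a Rauzy diagram *)

Section Intertwining.
Variables (A : finType) (V V' : realDomainType) (X : V -> V').

(** The map [X] carries endpoints to endpoints and conjugates the branches on
    the closed intervals of [D] only: the map to which this applies is
    constant beyond the ends of an integer interval, and conjugates nothing
    there. *)
Definition intertwines (D : branches A V) (D' : branches A V') : Prop :=
  (forall e c, lft D' e c = X (lft D e c) /\ rgt D' e c = X (rgt D e c)) /\
  (forall e c x, lft D e c <= x <= rgt D e c -> brn D' e c (X x) = X (brn D e c x)).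

Lemma brn_itv (D : branches A V) e c x : branched D ->
  lft D e c <= x <= rgt D e c ->
  lft D (other e) c <= brn D e c x <= rgt D (other e) c.
Proof. by move=> bD; rewrite -(brn_lft bD) -(brn_rgt bD) !(brn_le_mono _ _ bD). Qed.

(** The cut point is the image of an endpoint by a branch, and the composed
    branches are only applied inside of intervals, so that a step preserves
    the relation. *)
Lemma rauzy_step_intertwines pi e w l (D : branches A V) (D' : branches A V') :
  last_letter pi e = Some w -> last_letter pi (other e) = Some l -> w != l ->
  tiled pi D -> branched D -> lft D e w <= lft D (other e) l ->
  intertwines D D' -> intertwines (rauzy_step e w l D) (rauzy_step e w l D').
Proof.
move=> win lose wl tD bD le [hE hB].
have lst := last_ends win lose tD.
have lw_itv : lft D e w <= lft D (other e) l <= rgt D e w.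
  by rewrite le lst (tile_le tD).
have cutE : cut_point e w l D' = X (cut_point e w l D) by rewrite /cut_point (hE _ _).1 hB.
have c1 := lft_cut bD le; have c2 := cut_rgt win lose tD bD.
split.
  move=> e' c /=; have [hl hr] := hE e' c; have [hwl hwr] := hE e' w.
  by split; repeat case: ifP => // _; rewrite ?cutE // (hE _ _).1.
move=> e' c x /=.
have [->|/neq_other->] := eqVneq e' e; rewrite ?otherK ?eqxx ?other_neq /=.
  have [->|cl] := eqVneq c l.
    rewrite eq_sym (negbTE wl) => xl /=; rewrite hB // hB //.
    have /andP[h1 h2] := brn_itv bD xl.
    by rewrite (le_trans le h1) lst.
  have [->|cw] := eqVneq c w; last exact: hB.
  by move=> /andP[h1 h2]; apply: hB; rewrite h1 lst (le_trans h2) ?(tile_le tD).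
have [->|cl] := eqVneq c l.
  rewrite eq_sym (negbTE wl) => /andP[h1 h2] /=.
  have xw : lft D (other e) w <= x <= rgt D (other e) w by rewrite h2 (le_trans c1).
  rewrite (hB _ _ _ xw) hB //.
  have := brn_itv bD xw; rewrite otherK lst => /andP[_ ->]; rewrite andbT.
  have -> : lft D (other e) l = brn D (other e) w (cut_point e w l D).
    by rewrite /cut_point (brnK bD).
  by rewrite (brn_le_mono _ _ bD).
have [->|cw] := eqVneq c w; last exact: hB.
by move=> /andP[h1 h2]; apply: hB; rewrite h1 (le_trans h2).
Qed.

End Intertwining.

(** An infinite Rauzy path with its winners [w] and losers [l]. *)
Record rauzy_walk (A : finType) (P : nat -> datum A) (e : nat -> side)
    (w l : nat -> A) : Prop := RauzyWalk {
  walk_datum : forall k, is_datum (P k);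
  walk_next : forall k, P k.+1 = rauzy_op (e k) (P k);
  walk_win : forall k, last_letter (P k) (e k) = Some (w k);
  walk_lose : forall k, last_letter (P k) (other (e k)) = Some (l k);
  walk_neq : forall k, w k != l k }.

Section Walk.
Variables (A : finType) (P : nat -> datum A) (e : nat -> side) (w l : nat -> A).
Hypothesis walk : rauzy_walk P e w l.

(** The steps are prescribed by the walk and not by the branches, so that the
    result is defined for all branches and depends continuously on them. *)
Fixpoint renormalize V (D : branches A V) (k : nat) : branches A V :=
  if k is j.+1 then rauzy_step (e j) (w j) (l j) (renormalize D j) else D.

Definition weakly_follows (V : realDomainType) (D : branches A V) (n : nat) : Prop :=
  forall k, (k < n)%N -> lft (renormalize D k) (e k) (w k)
                      <= lft (renormalize D k) (other (e k)) (l k).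

Lemma renormalize_tiled (V : realDomainType) (D : branches A V) n k :
  tiled (P 0) D -> branched D -> weakly_follows D n -> (k <= n)%N ->
  tiled (P k) (renormalize D k) /\ branched (renormalize D k).
Proof.
move=> tD bD fD; elim: k => [//|k IHk] kn; have [tk bk] := IHk (ltnW kn).
rewrite /= (walk_next walk); split.
  apply: rauzy_step_tiled (fD k kn) => //; first exact: (walk_datum walk).
  - exact: (walk_win walk).
  - exact: (walk_lose walk).
  - exact: (walk_neq walk).
apply: rauzy_step_branched tk bk => //; first exact: (walk_win walk).
- exact: (walk_lose walk).
- exact: (walk_neq walk).
Qed.

(** Undoing a step adds the length of the loser to that of the winner;
    starting from lengths one after [n] steps, all the lengths stay positive
    integers. *)
Lemma backward_lengths n : exists lam : nat -> A -> nat, (forall k c, 0 < lam k c)%N /\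
  forall k c, (k < n)%N -> lam k c = (lam k.+1 c + (if c == w k then lam k.+1 (l k) else 0))%N.
Proof.
suff H m : forall k, exists lam : nat -> A -> nat, (forall j c, 0 < lam j c)%N /\
  forall j c, (k <= j < k + m)%N ->
    lam j c = (lam j.+1 c + (if c == w j then lam j.+1 (l j) else 0))%N.
  by have [lam [h0 h]] := H n 0%N; exists lam; split=> // k c kn; apply: h.
elim: m => [|m IHm] k.
  exists (fun _ _ => 1%N); split=> // j c; rewrite addn0.
  by case: leqP => // h /(leq_trans h); rewrite ltnn.
have [lam [h0 h]] := IHm k.+1.
exists (fun j c => if j == k
  then (lam k.+1 c + (if c == w k then lam k.+1 (l k) else 0))%N else lam j c).
split=> [j c|j c /andP[kj jm]].
  by case: eqVneq => // _; rewrite ltn_addr.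
have [->|jk] := eqVneq j k; first by rewrite gtn_eqF.
have kj' : (k < j)%N by rewrite ltn_neqAle eq_sym jk kj.
have -> : (j.+1 == k) = false by rewrite gtn_eqF // leqW.
by apply: h; rewrite kj' addSnnS.
Qed.

(** An interval exchange with the lengths [lam], without reference to the
    order of its intervals. *)
Definition translating (lam : A -> nat) (D : branches A int) : Prop :=
  forall e c, rgt D e c = lft D e c + (lam c)%:Z /\
    forall x, brn D e c x = x + (lft D (other e) c - lft D e c).

Lemma translating_branched lam D : translating lam D -> branched D.
Proof.
move=> h; split=> [e' c x y xy|e' c x|e' c|e' c].
- by rewrite !(h _ _).2 lerD2r.
- by rewrite !(h _ _).2 otherK; lra.
- by rewrite (h _ _).2; lra.
- by rewrite (h _ _).2 !(h _ _).1; lra.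
Qed.

(** For translations a step replaces the length of the winner by its
    difference with the length of the loser, which is what the recursion on
    [lam] undoes; the inequality of the step is the nonnegativity of that
    difference. *)
Lemma translating_follows lam n (D : branches A int) : tiled (P 0) D ->
  translating (lam 0%N) D ->
  (forall k c, (k < n)%N -> lam k c = (lam k.+1 c + (if c == w k then lam k.+1 (l k) else 0))%N) ->
  weakly_follows D n.
Proof.
move=> tD hD hlam.
suff H m : (m <= n)%N -> weakly_follows D m /\ translating (lam m) (renormalize D m).
  by have [] := H n (leqnn n).
elim: m => [//|m IHm] mn; have [fm hm] := IHm (ltnW mn).
have [tm bm] := renormalize_tiled tD (translating_branched hD) fm (leqnn m).
have wl := walk_neq walk m.
have lst : rgt (renormalize D m) (e m) (w m) = rgt (renormalize D m) (other (e m)) (l m).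
  by apply: (tile_last tm); apply: last_letterP; [exact: (walk_win walk)|exact: (walk_lose walk)].
have lamw := hlam m (w m) mn; rewrite eqxx in lamw.
have laml := hlam m (l m) mn; rewrite eq_sym (negbTE wl) addn0 in laml.
have {}lamw : (lam m (w m))%:Z = (lam m.+1 (w m))%:Z + (lam m (l m))%:Z by rewrite lamw -laml PoszD.
have lam0 := le0z_nat (lam m.+1 (w m)).
have lamN c : c != w m -> lam m c = lam m.+1 c.
  by move=> cw; rewrite hlam // (negbTE cw) addn0.
have [rw bw] := hm (e m) (w m); have [rl bl] := hm (other (e m)) (l m).
have [rw' bw'] := hm (other (e m)) (w m); have [rl' bl'] := hm (e m) (l m).
rewrite otherK in bl bw'.
split.
  move=> k; rewrite ltnS leq_eqVlt => /orP[/eqP->|]; last exact: fm.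
  by move: lst; rewrite rw rl lamw; lra.
move=> e' c /=.
rewrite /cut_point bw.
have [->|/neq_other->] := eqVneq e' (e m); rewrite ?otherK ?eqxx ?other_neq /=.
  have [->|cw] := eqVneq c (w m).
    rewrite (negbTE wl); split; last exact: bw.
    by move: lst; rewrite rw rl lamw; lra.
  rewrite -lamN //; have [->|cl] := eqVneq c (l m); last exact: (hm (e m) c).
  split=> [|x]; first by rewrite rl'.
  by rewrite /= bl' bw; lra.

have [->|cw] := eqVneq c (w m).
  rewrite (negbTE wl); split=> [|x]; last exact: bw'.
  by move: lst; rewrite rw rl lamw; lra.
rewrite -lamN //; have [->|cl] := eqVneq c (l m); last first.
  by have [h1 h2] := hm (other (e m)) c; rewrite otherK in h2.
split=> [|x]; first by move: lst; rewrite rw' rl rw; lra.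
by rewrite /= bw' bl; lra.
Qed.

Definition int_iet (pi : datum A) (lam : A -> nat) : branches A int :=
  let p e c := (\sum_(x | (pi e x < pi e c)%N) lam x)%N%:Z in
  {| lft := p; rgt e c := p e c + (lam c)%:Z; brn e c x := x + (p (other e) c - p e c) |}.

Lemma int_iet_translating pi lam : translating lam (int_iet pi lam).
Proof. by []. Qed.

Lemma int_iet_rgt pi lam e' c : is_datum pi -> pi e' c = #|A| ->
  rgt (int_iet pi lam) e' c = (\sum_x lam x)%N%:Z.
Proof.
move=> pd ec; rewrite /= -PoszD; congr Posz; rewrite [RHS](bigD1 c) //= addnC.
congr addn; apply: eq_bigl => x.
rewrite -(inj_eq (datum_inj (e := e') pd)) ltn_neqAle ec.
by have /andP[_ ->] := datum_range e' x pd; rewrite andbT.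
Qed.

Lemma int_iet_tiled pi lam : is_datum pi -> tiled pi (int_iet pi lam).
Proof.
move=> pd; split=> [e' c|e' c c' cc'|e' c c1|e' c c' h h'].
- by rewrite /= lerDl.
- rewrite /= -PoszD; congr Posz; rewrite [RHS](bigD1 c) ?cc' //= addnC.
  congr addn; apply: eq_bigl => x.
  by rewrite ltnS -(inj_eq (datum_inj (e := e') pd)) ltn_neqAle andbC.
- rewrite /= big_pred0 // => x; rewrite c1 ltnS leqn0.
  by have := datum_range e' x pd; case: (pi e' x).
- by rewrite !int_iet_rgt.
Qed.

Section IntertwinedWalks.
Variables (V V' : realDomainType) (X : V -> V').
Hypothesis X_le : {homo X : x y / x <= y}.

(** A monotone map carries the inequalities between endpoints from one family
    of branches to the other. *)
Lemma intertwines_follows (D : branches A V) (D' : branches A V') n :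
  tiled (P 0) D -> branched D -> weakly_follows D n -> intertwines X D D' ->
  weakly_follows D' n.
Proof.
move=> tD bD fD h k kn.
have H m : (m <= n)%N -> intertwines X (renormalize D m) (renormalize D' m).
  elim: m => [//|m IHm] mn /=.
  have [tm bm] := renormalize_tiled tD bD fD (ltnW mn).
  apply: rauzy_step_intertwines tm bm _ (IHm (ltnW mn)); last exact: fD.
  - exact: (walk_win walk).
  - exact: (walk_lose walk).
  - exact: (walk_neq walk).
have [hE _] := H k (ltnW kn).
by rewrite (hE _ _).1 (hE (other _) _).1 X_le // fD.
Qed.

End IntertwinedWalks.

Section NoDegenerateLetter.
Variables (V : realDomainType) (D : branches A V).
Hypotheses (tD : tiled (P 0) D) (bD : branched D).
Hypothesis fD : forall n, weakly_follows D n.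
Hypothesis wins : forall c n, exists2 k, (n <= k)%N & w k = c.
Hypothesis nondegenerate : exists c, lft D Top c != rgt D Top c.

Let tk k : tiled (P k) (renormalize D k).
Proof. by have [] := renormalize_tiled tD bD (fD (n := k)) (leqnn k). Qed.
Let bk k : branched (renormalize D k).
Proof. by have [] := renormalize_tiled tD bD (fD (n := k)) (leqnn k). Qed.

(** Since branches are homeomorphisms, a letter is degenerate on both sides or
    on none; the top side is a choice. *)
Definition null k c : bool := lft (renormalize D k) Top c == rgt (renormalize D k) Top c.

Lemma nullE k e' c : (lft (renormalize D k) e' c == rgt (renormalize D k) e' c) = null k c.
Proof.
rewrite /null; case: e' => //.
rewrite -[RHS](inj_eq (can_inj (brnK (bk k) Top c))).
by rewrite (brn_lft (bk k)) (brn_rgt (bk k)).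
Qed.

Lemma renormalize_last_ends k :
  rgt (renormalize D k) (e k) (w k) = rgt (renormalize D k) (other (e k)) (l k).
Proof. exact: (last_ends (walk_win walk k) (walk_lose walk k) (tk k)). Qed.

Lemma nullS k c : c != w k -> null k.+1 c = null k c.
Proof.
move=> cw; rewrite -!(nullE _ (e k)) /= eqxx (negbTE cw) /=.
by [].
Qed.

(** A tie between the winner and the loser is what makes a letter degenerate. *)
Lemma null_winnerS k : null k.+1 (w k) =
  (lft (renormalize D k) (e k) (w k) == lft (renormalize D k) (other (e k)) (l k)).
Proof. by rewrite -(nullE _ (e k)) /= !eqxx. Qed.

Lemma null_mono k c : null k c -> null k.+1 c.
Proof.
have [->|cw] := eqVneq c (w k); last by rewrite nullS.
rewrite null_winnerS -(nullE _ (e k)) => /eqP E.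
rewrite eq_le (fD (ltnSn k)) /= E renormalize_last_ends; exact: (tile_le (tk k)).
Qed.

(** The last interval of the loser lies in the last interval of the winner. *)
Lemma null_loser k : null k (w k) -> null k (l k).
Proof.
rewrite -(nullE _ (e k)) -(nullE k (other (e k)) (l k)) => /eqP E.
rewrite eq_le (tile_le (tk k)) /= -renormalize_last_ends -E; exact: (fD (ltnSn k)).
Qed.

(** If the winner was the nondegenerate letter, either the loser is
    nondegenerate too, and its length on the side of the winner does not
    change, or the step does not shorten the winner. *)
Lemma exists_not_null k : exists c, ~~ null k c.
Proof.
elim: k => [|k [c ck]]; first exact: nondegenerate.
have [cw|cw] := eqVneq c (w k); last by exists c; rewrite nullS.
have [lk|lk] := boolP (null k (l k)); last first.
  by exists (l k); rewrite nullS // eq_sym (walk_neq walk).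
exists (w k); rewrite null_winnerS; subst c; apply: contra ck => /eqP E.
by rewrite -(nullE _ (e k)) renormalize_last_ends E nullE.
Qed.

(** The winner stays last on its side, so at the next step it wins again or
    loses. *)
Lemma winner_change k : w k.+1 = w k \/ l k.+1 = w k.
Proof.
have E : last_letter (P k.+1) (e k) = Some (w k).
  rewrite -(walk_win walk k) /last_letter; apply: eq_pick => c.
  by rewrite (walk_next walk) (rauzy_opE (walk_win walk k) (walk_lose walk k)) eqxx.
have [ek|/neq_other ek] := eqVneq (e k.+1) (e k).
  by left; have := walk_win walk k.+1; rewrite ek E => -[].
by right; have := walk_lose walk k.+1; rewrite ek otherK E => -[].
Qed.

(** Once the set [Z] of degenerate letters is constant, a degenerate winner
    has a degenerate loser. A nondegenerate winner is hence never followed by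
    a degenerate one, for which the former winner would be the loser; as every
    letter wins again, [Z] is empty. *)
Lemma no_null k c : ~~ null k c.
Proof.
pose Z j := [set c | null j c]%SET.
have Zstep j : Z j \subset Z j.+1.
  by apply/fintype.subsetP => x; rewrite !inE; exact: null_mono.
have Zmono i j : (i <= j)%N -> Z i \subset Z j.
  move=> /subnK <-; elim: (j - i)%N => [|m IHm]; first exact: subxx.
  exact: fintype.subset_trans IHm (Zstep _).
(* The increasing sets Z j stop growing when their cardinal is maximal. *)
have [K hK] : exists K, forall j, (#|Z j| <= #|Z K|)%N.
  pose Q := [pred n | `[< exists j, #|Z j| = n >]].
  have exQ : exists n, Q n by exists #|Z 0%N|; apply/asboolP; exists 0%N.
  have ubQ n : Q n -> (n <= #|A|)%N by move=> /asboolP[j <-]; exact: max_card.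
  have [_ /asboolP[K <-] hK] := ex_maxnP exQ ubQ.
  by exists K => j; apply: hK; apply/asboolP; exists j.
have stable j x : (K <= j)%N -> null j x = null K x.
  move=> Kj; suff /setP/(_ x) : Z K = Z j by rewrite !inE.
  by apply/eqP; rewrite eqEcard Zmono //= hK.
have [a aK] := exists_not_null K; have [m Km wm] := wins a K.
have wK i : ~~ null K (w (m + i)).
  elim: i => [|i IHi]; first by rewrite addn0 wm.
  rewrite addnS; have [->//|E] := winner_change (m + i).
  apply: contra IHi; rewrite -E -!(stable (m + i).+1); last 2 first.
  - by rewrite leqW // (leq_trans Km) // leq_addr.
  - by rewrite leqW // (leq_trans Km) // leq_addr.
  exact: null_loser.
have [j mj wj] := wins c m.
have cK : ~~ null K c by have := wK (j - m)%N; rewrite subnKC // wj.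
apply: contra cK => ck; rewrite -(stable (maxn k K)) ?leq_maxr //.
have /fintype.subsetP/(_ c) := Zmono k (maxn k K) (leq_maxl _ _).
by rewrite !inE; apply.
Qed.

Lemma renormalize_lt k e' c : lft (renormalize D k) e' c < rgt (renormalize D k) e' c.
Proof. by rewrite lt_def eq_sym nullE no_null (tile_le (tk k)). Qed.

Lemma strictly_follows k :
  lft (renormalize D k) (e k) (w k) < lft (renormalize D k) (other (e k)) (l k).
Proof. by rewrite lt_def eq_sym -null_winnerS no_null (fD (ltnSn k)). Qed.

End NoDegenerateLetter.
End Walk.

(** * Monotone arcs and the Hausdorff distance *)

Section Arcs.
Variable R : realType.
Implicit Types (K : set (R * R)) (p q : side -> R) (h : side -> R -> R).

(** The set [K] is the graph of an increasing homeomorphism between two closed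
    intervals, or a point, and [h] is its extension to the line by
    translations on either side, together with the inverse. The extension
    makes sense even for a point, where it is a translation, and it varies
    continuously with [K]. *)
Record monotone_arc K p q h : Prop := MonotoneArc {
  arc_le : p Top <= q Top;
  arc_homo : forall e, {homo h e : x y / x <= y};
  arcK : forall e, cancel (h e) (h (other e));
  arc_low : forall e x, x <= p e -> h e x = x - p e + p (other e);
  arc_high : forall e x, q e <= x -> h e x = x - q e + q (other e);
  arc_set : forall z, K z <-> p Top <= z.1 <= q Top /\ z.2 = h Top z.1 }.

Definition crd (e : side) (z : R * R) : R := if e is Top then z.1 else z.2.

Section OneArc.
Variables (K : set (R * R)) (p q : side -> R) (h : side -> R -> R).
Hypothesis aK : monotone_arc K p q h.

Lemma arc_lft e : h e (p e) = p (other e).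
Proof. by rewrite (arc_low aK) // subrr add0r. Qed.

Lemma arc_rgt e : h e (q e) = q (other e).
Proof. by rewrite (arc_high aK) // subrr add0r. Qed.

Lemma arc_le_side e : p e <= q e.
Proof.
case: e; first exact: (arc_le aK).
by rewrite -[Bot]/(other Top) -arc_lft -arc_rgt; apply: (arc_homo aK); exact: (arc_le aK).
Qed.

Lemma arc_homoE e : {mono h e : x y / x <= y}.
Proof.
move=> x y; apply/idP/idP => [xy|]; last exact: (arc_homo aK).
by rewrite -(arcK aK e x) -(arcK aK e y); exact: (arc_homo aK).
Qed.

Lemma arc_crd e z : K z -> [/\ p e <= crd e z, crd e z <= q e & crd (other e) z = h e (crd e z)].
Proof.
case: z => x y /(arc_set aK)[/= /andP[px xq] ->]; case: e => //=; split.
- by rewrite -[Bot]/(other Top) -arc_lft (arc_homoE Top).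
- by rewrite -[Bot]/(other Top) -arc_rgt (arc_homoE Top).
- by rewrite (arcK aK Top).
Qed.

Lemma arc_pt e x : p e <= x -> x <= q e -> exists2 z, K z & crd e z = x.
Proof.
case: e => px xq.
  by exists (x, h Top x) => //; apply/(arc_set aK); rewrite /= px xq.
exists (h Bot x, x) => //; apply/(arc_set aK) => /=; split.
  rewrite -[Top]/(other Bot) -arc_lft -arc_rgt !(arc_homoE Bot) px.
  exact: xq.
by rewrite (arcK aK Bot).
Qed.

Lemma arc_nonempty : K !=set0.
Proof. by have [z Kz _] := arc_pt (lexx (p Top)) (arc_le aK); exists z. Qed.

End OneArc.

Lemma eucl_dist_ge0 (z z' : R * R) : 0 <= eucl_dist z z'.
Proof. exact: sqrtr_ge0. Qed.

Lemma crd_eucl_dist e (z z' : R * R) : `|crd e z - crd e z'| <= eucl_dist z z'.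
Proof.
rewrite -sqrtr_sqr /eucl_dist; apply: ler_wsqrtr.
by case: e => /=; rewrite ?lerDl ?lerDr sqr_ge0.
Qed.

Lemma eucl_dist_le (z z' : R * R) : eucl_dist z z' <= `|z.1 - z'.1| + `|z.2 - z'.2|.
Proof.
rewrite -[leRHS]ger0_norm ?addr_ge0 // -sqrtr_sqr.
apply: ler_wsqrtr; rewrite [leRHS]sqrrD !real_normK ?num_real //.
by rewrite addrAC lerDl mulrn_wge0 // mulr_ge0.
Qed.

Lemma dist_to_ge0 K (z : R * R) : K !=set0 -> 0 <= dist_to K z.
Proof.
move=> [z0 Kz0]; apply: lb_le_inf; first by exists (eucl_dist z z0), z0.
by move=> _ [z' _ <-]; exact: eucl_dist_ge0.
Qed.

Definition within_eps eps K K' : Prop :=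
  forall z, K z -> exists2 z', K' z' & forall e, `|crd e z - crd e z'| < eps.

Lemma dist_to_ubound K p q h K' p' q' h' :
  monotone_arc K p q h -> monotone_arc K' p' q' h' ->
  has_ubound [set dist_to K' z | z in K].
Proof.
move=> aK aK'; have [z0 K'z0] := arc_nonempty aK'.
exists (\sum_(e <- [:: Top; Bot]) (`|p e - crd e z0| + `|q e - crd e z0|)) => _ [z Kz <-].
apply: (@le_trans _ _ (eucl_dist z z0)).
  apply: inf_lbound; last by exists z0.
  by exists 0 => _ [? _ <-]; exact: eucl_dist_ge0.
apply: le_trans (eucl_dist_le _ _) _; rewrite !big_cons big_nil addr0.
have H e : `|crd e z - crd e z0| <= `|p e - crd e z0| + `|q e - crd e z0|.
  have [h1 h2 _] := arc_crd aK e Kz.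
  rewrite ler_norml; have := ler_norm (q e - crd e z0).
  have := ler_norm (- (p e - crd e z0)); rewrite normrN.
  have := normr_ge0 (p e - crd e z0); have := normr_ge0 (q e - crd e z0).
  lra.
by apply: lerD; [exact: (H Top)|exact: (H Bot)].
Qed.

Lemma hausdorff_distC K K' : hausdorff_dist K K' = hausdorff_dist K' K.
Proof. by rewrite /hausdorff_dist maxC. Qed.

Lemma hausdorff_dist_ge0 K p q h K' p' q' h' :
  monotone_arc K p q h -> monotone_arc K' p' q' h' -> 0 <= hausdorff_dist K K'.
Proof.
move=> aK aK'; rewrite /hausdorff_dist le_max; apply/orP; left.
have [z Kz] := arc_nonempty aK.
apply: le_trans (dist_to_ge0 z (arc_nonempty aK')) _.
by apply: (ub_le_sup (dist_to_ubound aK aK')); exists z.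
Qed.

Lemma hausdorff_within K p q h K' p' q' h' eps :
  monotone_arc K p q h -> monotone_arc K' p' q' h' ->
  hausdorff_dist K K' < eps -> within_eps eps K K'.
Proof.
move=> aK aK' hd z Kz; apply: contrapT => far.
suff : eps <= dist_to K' z.
  apply/negP; rewrite -ltNge; apply: le_lt_trans hd.
  rewrite /hausdorff_dist le_max; apply/orP; left.
  by apply: (ub_le_sup (dist_to_ubound aK aK')); exists z.
apply: lb_le_inf; first by have [z' K'z'] := arc_nonempty aK'; exists (eucl_dist z z'), z'.
move=> _ [z' K'z' <-]; rewrite leNgt; apply/negP => lt; apply: far.
by exists z' => // e; apply: le_lt_trans lt; exact: crd_eucl_dist.
Qed.

Section TwoArcs.
Variables (K : set (R * R)) (p q : side -> R) (h : side -> R -> R).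
Variables (K' : set (R * R)) (p' q' : side -> R) (h' : side -> R -> R).
Hypotheses (aK : monotone_arc K p q h) (aK' : monotone_arc K' p' q' h').
Variable eps : R.
Hypotheses (near1 : within_eps eps K K') (near2 : within_eps eps K' K).

(** The endpoints are extreme values of the coordinates on the two arcs. *)
Lemma corners_close e : `|p e - p' e| < eps /\ `|q e - q' e| < eps.
Proof.
have [z Kz pz] := arc_pt aK (lexx (p e)) (arc_le_side aK e).
have [y K'y py] := arc_pt aK' (lexx (p' e)) (arc_le_side aK' e).
have [z' K'z' /(_ e) dz] := near1 Kz; have [y' Ky' /(_ e) dy] := near2 K'y.
have [u Ku qu] := arc_pt aK (arc_le_side aK e) (lexx (q e)).
have [v K'v qv] := arc_pt aK' (arc_le_side aK' e) (lexx (q' e)).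
have [u' K'u' /(_ e) du] := near1 Ku; have [v' Kv' /(_ e) dv] := near2 K'v.
have [a1 a2 _] := arc_crd aK' e K'z'; have [b1 b2 _] := arc_crd aK e Ky'.
have [c1 c2 _] := arc_crd aK' e K'u'; have [d1 d2 _] := arc_crd aK e Kv'.
move: dz dy du dv; rewrite !ltr_norml pz py qu qv; lra.
Qed.

(** Inside the arc a close point of the other arc and monotonicity suffice.
    Outside, both extensions have slope one and their corners are close. *)
Lemma levy_le e x : h' e (x - 2 * eps) <= h e x + 2 * eps.
Proof.
have [p1 q1] := corners_close e; have [p2 q2] := corners_close (other e).
move: p1 q1 p2 q2; rewrite !ltr_norml => p1 q1 p2 q2.
have [xp|px] := ltP x (p e).
  by rewrite (arc_low aK) ?ltW // (arc_low aK'); lra.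
have [xq|qx] := leP x (q e).
  have [z Kz zx] := arc_pt aK px xq; have [_ _ zE] := arc_crd aK e Kz.
  have [z' K'z' dz] := near1 Kz; have [_ _ z'E] := arc_crd aK' e K'z'.
  have := dz e; have := dz (other e); rewrite !ltr_norml zE z'E zx => d1 d2.
  have lez : x - 2 * eps <= crd e z' by lra.
  by have := arc_homo aK' e lez; lra.
rewrite (arc_high aK (ltW qx)).
have [qx'|x'q] := leP (q' e) (x - 2 * eps).
  by rewrite (arc_high aK') //; lra.
apply: le_trans (arc_homo aK' e (ltW x'q)) _.
by rewrite (arc_rgt aK'); lra.
Qed.

End TwoArcs.

(** Graphs that are close in the sense of Levy give close values near a point
    where the limit is continuous; the continuity of an increasing bijection
    is read on its inverse [g0]. *)
Lemma levy_cvg (T : Type) (F : set_system T) {FF : Filter F} (h : T -> R -> R)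
    (h0 g0 : R -> R) (x0 : R) :
  {homo h0 : x y / x <= y} -> {homo g0 : x y / x <= y} -> cancel h0 g0 -> cancel g0 h0 ->
  (forall eps, 0 < eps -> \forall t \near F, forall x,
    h t (x - eps) <= h0 x + eps /\ h0 (x - eps) <= h t x + eps) ->
  h z.1 z.2 @[z --> (F, nbhs x0)] --> h0 x0.
Proof.
move=> hle gle hK gK levy; apply/cvgrPdist_lt => eta eta0.
have lt_g x y : x < h0 y -> g0 x < y.
  move=> xy; rewrite lt_neqAle -{2}(hK y) gle ?ltW // andbT.
  by apply: contraTneq xy => <-; rewrite gK ltxx.
have gt_g x y : h0 y < x -> y < g0 x.
  move=> xy; rewrite lt_neqAle -{2}(hK y) gle ?ltW // andbT.
  by apply: contraTneq xy => ->; rewrite gK ltxx.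
pose a := g0 (h0 x0 - eta / 2); pose b := g0 (h0 x0 + eta / 2).
have ax : a < x0 by apply: lt_g; lra.
have bx : x0 < b by apply: gt_g; lra.
(* Two shifts by d in the variable and the distance of x to x0 keep the
   argument between a and b, where h0 varies by at most eta / 2. *)
pose d := Num.min (Num.min (x0 - a) (b - x0)) eta / 4.
have d0 : 0 < d by rewrite /d divr_gt0 // !lt_min eta0 !subr_gt0 ax bx.
have [da db de] : [/\ 4 * d <= x0 - a, 4 * d <= b - x0 & 4 * d <= eta].
  by rewrite /d mulrC divfK //; split; rewrite !ge_min lexx ?orbT.
have ha : h0 a = h0 x0 - eta / 2 by exact: gK.
have hb : h0 b = h0 x0 + eta / 2 by exact: gK.
have nx : \forall x \near nbhs x0, `|x0 - x| < d by apply/nbhs_ballP; exists d.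
exists ([set t | forall x, h t (x - d) <= h0 x + d /\ h0 (x - d) <= h t x + d],
  [set x | `|x0 - x| < d]); first by split=> //; exact: levy.
move=> [t x] /= [lev]; have [h1 _] := lev (x + d); have [_ h2] := lev x.
rewrite addrK in h1; rewrite !ltr_norml => /andP[n1 n2].
have h3 : h0 (x + d) <= h0 b by apply: hle; lra.
have h4 : h0 a <= h0 (x - d) by apply: hle; lra.
by rewrite hb in h3; rewrite ha in h4; lra.
Qed.

End Arcs.

(** * Branches of a generalized interval exchange *)

Section Extension.
Variable R : realType.

Definition unit_slope_ext (p q p' q' : R) (f : R -> R) (x : R) : R :=
  if x < p then x - p + p' else if x < q then f x else x - q + q'.

Lemma unit_slope_ext_low p q p' q' f x : x < p -> unit_slope_ext p q p' q' f x = x - p + p'.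
Proof. by rewrite /unit_slope_ext => ->. Qed.

Lemma unit_slope_ext_in p q p' q' f x : p <= x -> x < q -> unit_slope_ext p q p' q' f x = f x.
Proof. by rewrite /unit_slope_ext leNgt => /negbTE-> ->. Qed.

Lemma unit_slope_ext_high p q p' q' f x : p <= q -> q <= x ->
  unit_slope_ext p q p' q' f x = x - q + q'.
Proof.
move=> pq qx; rewrite /unit_slope_ext ltNge (le_trans pq qx) /=.
by rewrite ltNge qx.
Qed.

Lemma unit_slope_ext_homo p q p' q' f : p < q -> p' < q' ->
  (forall x, p <= x -> x < q -> p' <= f x < q') ->
  (forall x y, p <= x -> x <= y -> y < q -> f x <= f y) ->
  {homo unit_slope_ext p q p' q' f : x y / x <= y}.
Proof.
move=> pq pq' fI fle x y xy.
have [xp|px] := ltP x p.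
  rewrite unit_slope_ext_low //; have [yp|py] := ltP y p;
    first by rewrite unit_slope_ext_low //; lra.
  have [yq|qy] := ltP y q; last by rewrite unit_slope_ext_high // ?ltW //; lra.
  by rewrite unit_slope_ext_in //; have /andP[h _] := fI y py yq; lra.
have py := le_trans px xy.
have [xq|qx] := ltP x q; last by rewrite !unit_slope_ext_high ?(ltW pq) //; lra.
rewrite unit_slope_ext_in //; have [yq|qy] := ltP y q; first by rewrite unit_slope_ext_in // fle.
by rewrite unit_slope_ext_high ?(ltW pq) //; have /andP[_ h] := fI x px xq; lra.
Qed.

Lemma unit_slope_ext_cancel p q p' q' f g : p < q -> p' < q' ->
  (forall x, p <= x -> x < q -> p' <= f x < q') ->
  (forall x, p <= x -> x < q -> g (f x) = x) ->
  cancel (unit_slope_ext p q p' q' f) (unit_slope_ext p' q' p q g).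
Proof.
move=> pq pq' fI gf x.
have [xp|px] := ltP x p; first by rewrite (unit_slope_ext_low _ _ _ _ xp) unit_slope_ext_low; lra.
have [xq|qx] := ltP x q;
  last by rewrite (unit_slope_ext_high _ _ _ (ltW pq) qx) unit_slope_ext_high ?(ltW pq') //; lra.
rewrite (unit_slope_ext_in _ _ _ px xq); have /andP[h1 h2] := fI x px xq.
by rewrite unit_slope_ext_in // gf.
Qed.

Lemma nbhs_pairP (z : R * R) (B : set (R * R)) : nbhs z B <->
  exists2 eps : R, 0 < eps & forall y, `|z.1 - y.1| < eps -> `|z.2 - y.2| < eps -> B y.
Proof.
split=> [/nbhs_ballP[eps /= eps0 h]|[eps eps0 h]].
  by exists eps => // y h1 h2; apply: h.
by apply/nbhs_ballP; exists eps => // y [h1 h2]; apply: h.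
Qed.

(** The extension of the branch is an increasing bijection of the line, so it
    takes the right values at the excluded right endpoint, and the closure of
    the graph only adds the upper right corner. *)
Lemma branch_arc (p q p' q' : R) (f : R -> R) : p < q -> p' < q' ->
  op_homeo [set` `[p, q[] [set` `[p', q'[] f ->
  exists h, monotone_arc
    (closure [set z | [set` `[p, q[] z.1 /\ z.2 = f z.1])
    (fun e => if e is Top then p else p') (fun e => if e is Top then q else q') h
    /\ forall x, p <= x -> x < q -> f x = h Top x.
Proof.
move=> pq pq' [[fX fI fS] _ [g [_ gf]] flt].
have fI' x : p <= x -> x < q -> p' <= f x < q'.
  by move=> px xq; have := fX x; rewrite /= !in_itv /= px xq; exact.
have gf' x : p <= x -> x < q -> g (f x) = x.
  by move=> px xq; apply: gf; rewrite /= in_itv /= px.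
have fg y : p' <= y -> y < q' -> p <= g y < q /\ f (g y) = y.
  move=> py yq; have [x /=] : (f @` [set` `[p, q[]) y by apply: fS; rewrite /= in_itv /= py.
  by rewrite in_itv /= => /andP[px xq] <-; rewrite gf' // px.
have fle x y : p <= x -> x <= y -> y < q -> f x <= f y.
  move=> px; rewrite le_eqVlt => /orP[/eqP->//|xy] yq.
  by apply: ltW; apply: flt; rewrite //= in_itv /= ?px ?(lt_trans xy) ?(le_trans px (ltW xy)).
have gle x y : p' <= x -> x <= y -> y < q' -> g x <= g y.
  move=> px xy yq; have [/andP[gx1 gx2] fx] := fg x px (le_lt_trans xy yq).
  have [/andP[gy1 gy2] fy] := fg y (le_trans px xy) yq.
  rewrite leNgt; apply/negP => lt; have := flt (g y) (g x).
  rewrite /= !in_itv /= gx1 gx2 gy1 gy2 fx fy => /(_ isT isT lt).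
  by rewrite ltNge xy.
pose h e := if e is Top then unit_slope_ext p q p' q' f else unit_slope_ext p' q' p q g.
have hK : cancel (h Top) (h Bot) by exact: unit_slope_ext_cancel.
have hK' : cancel (h Bot) (h Top).
  by apply: unit_slope_ext_cancel => // y py yq; have [] := fg y py yq.
have hle : {homo h Top : x y / x <= y} by exact: unit_slope_ext_homo.
have hle' : {homo h Bot : x y / x <= y}.
  by apply: unit_slope_ext_homo => // y py yq; have [] := fg y py yq.
have hlt x y : x < y -> h Top x < h Top y.
  move=> xy; rewrite lt_neqAle hle ?ltW // andbT.
  by apply: contraTneq xy => /(can_inj hK)->; rewrite ltxx.
have hlt' x y : x < y -> h Bot x < h Bot y.
  move=> xy; rewrite lt_neqAle hle' ?ltW // andbT.
  by apply: contraTneq xy => /(can_inj hK')->; rewrite ltxx.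
have hp : h Top p = p'.
  have [/andP[g1 g2] E] := fg p' (lexx _) pq'.
  have /andP[p'f _] := fI' p (lexx _) pq.
  by rewrite /h unit_slope_ext_in //; apply: le_anti; rewrite p'f andbT -E fle.
have hp' : h Bot p' = p by rewrite -[in LHS]hp hK.
have hq : h Top q = q' by rewrite /h unit_slope_ext_high ?(ltW pq) // subrr add0r.
have hf x : p <= x -> x < q -> f x = h Top x by move=> px xq; rewrite /h unit_slope_ext_in.
have hlow e x : x <= (if e is Top then p else p') ->
    h e x = x - (if e is Top then p else p') + (if other e is Top then p else p').
  case: e; rewrite le_eqVlt => /orP[/eqP->|xp] /=.
  - by rewrite subrr add0r; exact: hp.
  - exact: unit_slope_ext_low.
  - by rewrite subrr add0r; exact: hp'.
  - exact: unit_slope_ext_low.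
have hhigh e x : (if e is Top then q else q') <= x ->
    h e x = x - (if e is Top then q else q') + (if other e is Top then q else q').
  by case: e => qx; rewrite /= unit_slope_ext_high // ?(ltW pq) ?(ltW pq').
clearbody h; exists h; split=> //; split => //.
- exact: ltW.
- by case.
- by case.
move=> [x y] /=; split=> [cl|[/andP[px xq] ->]].
  have near_pt eps : 0 < eps -> exists u, [/\ p <= u, u < q, `|x - u| < eps & `|y - h Top u| < eps].
    move=> eps0; have [|[u v] [[/=]]] := cl [set z | `|x - z.1| < eps /\ `|y - z.2| < eps].
      by apply/nbhs_pairP; exists eps.
    by rewrite in_itv /= => /andP[pu uq] -> [xu yv]; exists u; rewrite -hf.
  split.
    apply/andP; split; rewrite leNgt; apply/negP => lt.
      have [|u [pu uq]] := near_pt (p - x); first by rewrite subr_gt0.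
      by rewrite ltr_norml; lra.
    have [|u [pu uq]] := near_pt (x - q); first by rewrite subr_gt0.
    by rewrite ltr_norml; lra.
  apply/eqP; apply: contraT; rewrite neq_lt => /orP[lt|gt].
    (* Points of the graph near (x, y) would have abscissas beyond the preimage
       of m and ordinates below m. *)
    pose m := (y + h Top x) / 2.
    have mx : h Bot m < x by rewrite -[ltRHS]hK; apply: hlt'; rewrite /m; lra.
    have [|u [pu uq]] := near_pt (Num.min (m - y) (x - h Bot m)).
      by rewrite lt_min !subr_gt0 mx andbT /m; lra.
    rewrite !lt_min => /andP[_ xu] /andP[yu _].
    have : m < h Top u by rewrite -[ltLHS]hK'; apply: hlt; move: xu; rewrite ltr_norml; lra.
    by move: yu; rewrite ltr_norml; lra.
  pose m := (y + h Top x) / 2.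
  have mx : x < h Bot m by rewrite -[ltLHS]hK; apply: hlt'; rewrite /m; lra.
  have [|u [pu uq]] := near_pt (Num.min (y - m) (h Bot m - x)).
    by rewrite lt_min !subr_gt0 mx andbT /m; lra.
  rewrite !lt_min => /andP[_ xu] /andP[yu _].
  have : h Top u < m by rewrite -[ltRHS]hK'; apply: hlt; move: xu; rewrite ltr_norml; lra.
  by move: yu; rewrite ltr_norml; lra.
move: xq; rewrite le_eqVlt => /orP[/eqP->|xq]; last first.
  by apply: subset_closure; rewrite /= in_itv /= px xq hf.
move=> B /nbhs_pairP[eps eps0 hB].
(* A point of [p, q[ close enough to q, along with its image to q'. *)
pose u := Num.max p (Num.max (q - eps / 2) (h Bot (q' - eps / 2))).
have [u1 u2 u3] : [/\ p <= u, q - eps / 2 <= u & h Bot (q' - eps / 2) <= u].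
  by rewrite /u !le_max !lexx !orbT.
have uq : u < q.
  rewrite /u !gt_max pq -[X in h Bot _ < X]hK hq; apply/andP; split=> //.
  by apply/andP; split; [lra|apply: hlt'; lra].
have := hle _ _ u3; rewrite hK' => hu; have := hlt _ _ uq; rewrite hq => hu'.
exists (u, h Top u); split; first by rewrite /= in_itv /= u1 uq hf.
by apply: hB; rewrite /= ?hq ltr_norml; lra.
Qed.

End Extension.

Section Realize.
Variables (R : realType) (A : finType).
Implicit Types (pi : datum A) (f : giet R A) (D : branches A R).

(** The invariant of Rauzy induction: a GIET described by endpoints and
    branches, those of the next stage being given by [rauzy_step]. *)
Record realizes pi (b : R) f D : Prop := Realizes {
  realizes_datum : gdatum f = pi;
  realizes_lo : glo f = 0;
  realizes_hi : ghi f = b;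
  realizes_int : forall e c, gint f e c = [set` `[lft D e c, rgt D e c[];
  realizes_map : forall c x, lft D Top c <= x -> x < rgt D Top c ->
    gmap f x = brn D Top c x }.

(** The intervals of a GIET are ordered, disjoint and cover [0, b[, and this
    forces them to be consecutive. *)
Lemma giet_realized pi b f : is_giet pi 0 b f -> exists D,
  [/\ realizes pi b f D, forall e c, lft D e c < rgt D e c, tiled pi D,
      forall e c, pi e c = #|A| -> rgt D e c = b
    & forall c, monotone_arc (closure (branch_graph f c))
        (lft D ^~ c) (rgt D ^~ c) (brn D ^~ c)].
Proof.
case=> [[pd b0] [fpi flo fhi] _ hI hB].
have /choice[pq hpq] : forall ec : side * A, exists pq : R * R,
    pq.1 < pq.2 /\ gint f ec.1 ec.2 = [set` `[pq.1, pq.2[].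
  move=> [e c]; have [/(_ c)[p [q [pq E]]] _ _ _] := hI e.
  by exists (p, q).
have ltpq e c : (pq (e, c)).1 < (pq (e, c)).2 by have [] := hpq (e, c).
have intE e c : gint f e c = [set` `[(pq (e, c)).1, (pq (e, c)).2[].
  by have [_] := hpq (e, c).
have /choice[h hh] : forall c, exists h,
    monotone_arc (closure (branch_graph f c)) (fun e => (pq (e, c)).1) (fun e => (pq (e, c)).2) h
    /\ forall x, (pq (Top, c)).1 <= x -> x < (pq (Top, c)).2 -> gmap f x = h Top x.
  move=> c; have := hB c; rewrite !intE => /(branch_arc (ltpq Top c) (ltpq Bot c))[h [ah fh]].
  exists h; split=> //; rewrite /branch_graph intE.
  have -> : (fun e => (pq (e, c)).1)
      = (fun e => if e is Top then (pq (Top, c)).1 else (pq (Bot, c)).1).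
    by apply/funext; case.
  have -> // : (fun e => (pq (e, c)).2)
      = (fun e => if e is Top then (pq (Top, c)).2 else (pq (Bot, c)).2).
  by apply/funext; case.
pose D := Branches (fun e c => (pq (e, c)).1) (fun e c => (pq (e, c)).2) (fun e c => h c e).
have domE : gdom f = [set` `[0, b[] by rewrite /gdom flo fhi.
have inI e c x : (lft D e c <= x < rgt D e c) -> 0 <= x < b.
  move=> hx; have : gdom f x.
    by have [_ _ <- _] := hI e; exists c => //; rewrite intE /= in_itv.
  by rewrite domE /= in_itv.
have cover e x : 0 <= x -> x < b -> exists c, lft D e c <= x < rgt D e c.
  move=> x0 xb; have : gdom f x by rewrite domE /= in_itv /= x0.
  have [_ _ <- _] := hI e => -[c _]; rewrite intE /= in_itv /= => hx.
  by exists c.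
have order e c c' : (pi e c < pi e c')%N -> forall x y, lft D e c <= x < rgt D e c ->
    lft D e c' <= y < rgt D e c' -> x < y.
  move=> cc' x y hx hy; have [_ _ _ /(_ c c' x y cc')] := hI e.
  by rewrite !intE /= !in_itv /=; apply.
have lftI e c : lft D e c <= lft D e c < rgt D e c by rewrite lexx ltpq.
have rgt_le e c : rgt D e c <= b.
  rewrite leNgt; apply/negP => lt.
  have /andP[l0 lb] := inI _ _ _ (lftI e c).
  have := inI e c b; rewrite lt (ltW lb) => /(_ isT).
  by rewrite ltxx andbF.
have sep e c c' : (pi e c < pi e c')%N -> rgt D e c <= lft D e c'.
  move=> cc'; rewrite leNgt; apply/negP => lt.
  have [le|le] := leP (lft D e c) (lft D e c').
    have := order e c c' cc' (lft D e c') (lft D e c').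
    by rewrite le lt lexx ltpq ltxx => /(_ isT isT).
  by have := order e c c' cc' _ _ (lftI e c) (lftI e c'); rewrite ltNge (ltW le).
have tot e c c' : c != c' -> (pi e c < pi e c')%N \/ (pi e c' < pi e c)%N.
  move=> ne; apply/orP; rewrite -neq_ltn; apply: contra ne => /eqP E.
  by apply/eqP; apply: (datum_inj (e := e) pd).
have last e c : pi e c = #|A| -> rgt D e c = b.
  move=> cA; apply/eqP; rewrite eq_le rgt_le leNgt; apply/negP => lt.
  have /andP[l0 _] := inI _ _ _ (lftI e c).
  have [x /andP[h1 h2]] := cover e (rgt D e c) (le_trans l0 (ltW (ltpq e c))) lt.
  have xc : x != c by apply: contraTneq h2 => ->; rewrite ltxx.
  have [xl|xl] := tot e _ _ xc.
    by have := sep e _ _ xl; rewrite leNgt (lt_trans (ltpq e c) h2).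
  by have /andP[_] := datum_range e x pd; rewrite -cA leqNgt xl.
exists D; split=> //.
- split=> //= c x h1 h2; exact: (hh c).2.
- split=> //= [e c|e c c' cc'|e c c1|e c c' h1 h2].
  + exact: ltW.
  + apply/eqP; rewrite eq_le; apply/andP; split; first by apply: sep; rewrite cc'.
    rewrite leNgt; apply/negP => lt.
    have /andP[l0 _] := inI _ _ _ (lftI e c); have /andP[_ lb] := inI _ _ _ (lftI e c').
    have [|x /andP[h1 h2]] := cover e (rgt D e c) (le_trans l0 (ltW (ltpq e c))).
      exact: lt_trans lb.
    have xc : x != c by apply: contraTneq h2 => ->; rewrite ltxx.
    have xc' : x != c' by apply: contraTneq h1 => ->; rewrite -ltNge.
    have [xl|xl] := tot e _ _ xc.
      by have := sep e _ _ xl; rewrite leNgt (lt_trans (ltpq e c) h2).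
    have [xl'|xl'] := tot e _ _ xc'; first by move: xl'; rewrite cc' ltnS leqNgt xl.
    by have := sep e _ _ xl'; rewrite leNgt (le_lt_trans h1) // (lt_trans lt) // ltpq.
  + have /andP[l0 _] := inI _ _ _ (lftI e c).
    have [x /andP[h1 h2]] := cover e 0 (lexx 0) b0.
    have [xc|xc] := eqVneq x c; first by subst x; apply/eqP; rewrite eq_le l0 h1.
    have [xl|xl] := tot e _ _ xc.
      by have := datum_range e x pd; rewrite c1 in xl; move: xl; case: (pi e x).
    by have := sep e _ _ xl; rewrite leNgt (le_lt_trans h1) // (le_lt_trans l0) // ltpq.
  + exact: etrans (last _ _ h1) (esym (last _ _ h2)).
- by move=> c; exact: (hh c).1.
Qed.

Lemma realizes_gcrit pi b f D e c : realizes pi b f D -> lft D e c < rgt D e c ->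
  gcrit f e c = lft D e c.
Proof.
by move=> rf lt; rewrite /gcrit (realizes_int rf) inf_itv.
Qed.

End Realize.

(** * Branches of a full family over the closed simplex *)

Section Density.
Variables (R : realType) (A : finType).
Let Cl := @closed_simplex R A.
Let Op := @open_simplex R A.

Lemma open_closed_simplex t : Op t -> Cl t.
Proof. by move=> [t0 t1]; split=> // c; exact: ltW. Qed.

(** Move slightly towards the barycentre. *)
Lemma open_simplex_dense t P : Cl t -> near_in Cl t P -> exists2 t', Op t' & P t'.
Proof.
move=> tC [d d0 hP]; have [t0 t1] := tC.
have n0 : 0 < #|A|%:R :> R.
  rewrite ltr0n lt0n; apply: contra_eq_neq t1 => /card0_eq A0.
  by rewrite big_pred0 // eq_sym oner_neq0.
have [n n1] : exists n : R, 0 < n <= 1 /\ n * #|A|%:R = 1.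
  exists (#|A|%:R^-1); rewrite invr_gt0 n0 mulVf ?gt_eqF //; split=> //.
  by rewrite /= invf_le1 // (ler_nat R 1) -(ltr0n R).
pose s := Num.min d 1 / 2.
have [s0 sd s1] : [/\ 0 < s, s < d & s < 1].
  have m0 : 0 < Num.min d 1 by rewrite lt_min d0 ltr01.
  have [md m1] : Num.min d 1 <= d /\ Num.min d 1 <= 1 by rewrite !ge_min !lexx orbT.
  by rewrite /s; split; lra.
have [/andP[np n1'] nA] := n1.
(* The coordinates of the barycentre are n = 1 / #|A|. *)
pose t' c := (1 - s) * t c + s * n.
have t'O : Op t'.
  split=> [c|].
    apply: ltr_wpDl; last exact: mulr_gt0.
    by apply: mulr_ge0 => //; lra.
  rewrite big_split -mulr_sumr t1 -mulr_sumr sumr_const.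
  by rewrite -[_ *+ _]mulr_natr /= nA; lra.
exists t' => //; apply: hP; first exact: open_closed_simplex.
move=> c; have /andP[c0 c1] := closed_simplex_le1 c tC.
have -> : t c - t' c = s * (t c - n) by rewrite /t'; lra.
rewrite normrM (gtr0_norm s0); apply: le_lt_trans sd.
by rewrite ler_piMr ?(ltW s0) // ler_norml; lra.
Qed.

(** Identities between the branches are established for GIETs and reach the
    boundary of the simplex by this density argument, with no analysis of the
    degenerations. *)
Lemma eq_on_closure (g g' : (A -> R) -> R) t : Cl t ->
  g x @[x --> near_in Cl t] --> g t -> g' x @[x --> near_in Cl t] --> g' t ->
  (forall x, Op x -> g x = g' x) -> g t = g' t.
Proof.
move=> tC cg cg' eqg; apply/eqP; rewrite -subr_eq0; apply: contraT => ne.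
have e0 : 0 < `|g t - g' t| / 2 by rewrite divr_gt0 // normr_gt0.
have /cvgrPdist_lt/(_ _ e0) n1 := cg; have /cvgrPdist_lt/(_ _ e0) n2 := cg'.
have [x xO [/= h1 h2]] := open_simplex_dense tC (filterI n1 n2).
have : `|g t - g' t| < `|g t - g' t|.
  rewrite [ltRHS]splitr; apply: le_lt_trans (ltrD h1 h2).
  by rewrite (eqg _ xO) [`|g' t - _|]distrC ler_distD.
by rewrite ltxx.
Qed.

End Density.

Section Family.
Variables (R : realType) (A : finType) (pi : datum A) (F : (A -> R) -> giet R A).
Hypotheses (pd : is_datum pi) (F_full : full_family pi F).
Let Cl := @closed_simplex R A.
Let Op := @open_simplex R A.

Lemma point_arc (s : R * R) : monotone_arc [set s] (fun e => crd e s) (fun e => crd e s)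
  (fun e x => x - crd e s + crd (other e) s).
Proof.
split=> //.
- by move=> e x y xy; lra.
- by move=> e x; rewrite otherK; lra.
case=> x y /=; split=> [<-|[/andP[h1 h2] ->]] /=; first by rewrite !lexx; split=> //; lra.
have -> : x = s.1 by apply: le_anti; rewrite h1 h2.
by rewrite subrr add0r -surjective_pairing.
Qed.

(** Branches of a degeneration: arcs for the letters of its regular part,
    points for the others. *)
Lemma ghat_arcs D : is_ghat pi 0 1 D -> exists B : branches A R,
  (forall c, monotone_arc (ghat_part D c) (lft B ^~ c) (rgt B ^~ c) (brn B ^~ c)) /\
  forall f, D = Regular f ->
    [/\ realizes pi 1 f B, forall e c, lft B e c < rgt B e c, tiled pi B
      & forall e c, pi e c = #|A| -> rgt B e c = 1].
Proof.
case: D => [f|B f s] /=.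
  by move=> /giet_realized[D [h1 h2 h3 h4 h5]]; exists D; split=> // g [<-]; split.
case=> _ /giet_realized[D [h1 h2 h3 h4 h5]] _.
pose D' : branches A R := Branches
  (fun e c => if insub c is Some c' then lft D e c' else crd e (s c))
  (fun e c => if insub c is Some c' then rgt D e c' else crd e (s c))
  (fun e c => if insub c is Some c' then brn D e c' else
    fun x => x - crd e (s c) + crd (other e) (s c)).
exists D'; split=> // c; rewrite /D' /=.
case: insub => [c'|]; first exact: h5.
exact: point_arc.
Qed.

(** The joint continuity of the branches is what makes the cut points, and
    hence all further steps, continuous. *)
Record continuous_branches (D : (A -> R) -> branches A R) : Prop := ContinuousBranches {
  cb_lft : forall t e c, Cl t -> lft (D t') e c @[t' --> near_in Cl t] --> lft (D t) e c;
  cb_brn : forall t x e c, Cl t ->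
    brn (D z.1) e c z.2 @[z --> (near_in Cl t, nbhs x)] --> brn (D t) e c x }.

(** On the bottom side the lengths are the coordinates of the parameter,
    including on the boundary of the simplex. *)
Record branch_family (D : (A -> R) -> branches A R) : Prop := BranchFamily {
  bf_continuous : continuous_branches D;
  bf_rgt : forall t e c, Cl t -> rgt (D t') e c @[t' --> near_in Cl t] --> rgt (D t) e c;
  bf_tiled : forall t, Cl t -> tiled pi (D t);
  bf_branched : forall t, Cl t -> branched (D t);
  bf_last : forall t e c, Cl t -> pi e c = #|A| -> rgt (D t) e c = 1;
  bf_bot : forall t c, Cl t -> rgt (D t) Bot c - lft (D t) Bot c = t c;
  bf_realizes : forall t, Op t -> realizes pi 1 (F t) (D t) }.

(** The branches are chosen separately at each parameter. They are continuous
    because those of two degenerations depend on the Hausdorff distance of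
    their parts only. *)
Lemma full_family_branches : exists D, branch_family D.
Proof.
have [Fg _ Fcrit [Fhat [hgh hreg hcont]]] := F_full.
have /choice[D hD] : forall t, exists D : branches A R, Cl t ->
  (forall c, monotone_arc (ghat_part (Fhat t) c) (lft D ^~ c) (rgt D ^~ c) (brn D ^~ c)) /\
  forall f, Fhat t = Regular f ->
    [/\ realizes pi 1 f D, forall e c, lft D e c < rgt D e c, tiled pi D
      & forall e c, pi e c = #|A| -> rgt D e c = 1].
  move=> t; have [tC|tC] := pselect (Cl t);
    last by exists (Branches (fun _ _ => 0) (fun _ _ => 0) (fun _ _ => id)).
  by have [B hB] := ghat_arcs (hgh t tC); exists B.
have arcs t c : Cl t -> monotone_arc (ghat_part (Fhat t) c)
    (lft (D t) ^~ c) (rgt (D t) ^~ c) (brn (D t) ^~ c).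
  by move=> tC; have [] := hD t tC.
have reg t : Op t -> [/\ realizes pi 1 (F t) (D t),
    forall e c, lft (D t) e c < rgt (D t) e c, tiled pi (D t)
      & forall e c, pi e c = #|A| -> rgt (D t) e c = 1].
  by move=> tO; have [_ h] := hD t (open_closed_simplex tO); apply: h; exact: hreg.
have near_arcs t eps : Cl t -> 0 < eps -> \forall t' \near near_in Cl t, Cl t' /\
    forall c, within_eps eps (ghat_part (Fhat t) c) (ghat_part (Fhat t') c) /\
              within_eps eps (ghat_part (Fhat t') c) (ghat_part (Fhat t) c).
  move=> tC eps0; have [d d0 hd] := hcont t tC eps eps0; exists d => // t' t'C tt'.
  split=> // c; have /= := hd t' t'C tt'; rewrite /ghat_dist => lt.
  have {}lt : hausdorff_dist (ghat_part (Fhat t) c) (ghat_part (Fhat t') c) < eps.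
    apply: le_lt_trans lt; rewrite (bigD1 c) //= lerDl sumr_ge0 // => b _.
    by apply: hausdorff_dist_ge0; exact: arcs.
  split; first exact: (hausdorff_within (arcs t c tC) (arcs t' c t'C) lt).
  rewrite hausdorff_distC in lt.
  exact: (hausdorff_within (arcs t' c t'C) (arcs t c tC) lt).
have lftC t e c : Cl t -> lft (D t') e c @[t' --> near_in Cl t] --> lft (D t) e c.
  move=> tC; apply/cvgrPdist_lt => eps eps0.
  apply: filterS (near_arcs t eps tC eps0) => t' [t'C /(_ c)[n1 n2]].
  by have [] := corners_close (arcs t c tC) (arcs t' c t'C) n1 n2 e.
have rgtC t e c : Cl t -> rgt (D t') e c @[t' --> near_in Cl t] --> rgt (D t) e c.
  move=> tC; apply/cvgrPdist_lt => eps eps0.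
  apply: filterS (near_arcs t eps tC eps0) => t' [t'C /(_ c)[n1 n2]].
  by have [] := corners_close (arcs t c tC) (arcs t' c t'C) n1 n2 e.
have sumC t c : Cl t -> \sum_(x | (pi Bot x < pi Bot c)%N) t' x @[t' --> near_in Cl t]
    --> \sum_(x | (pi Bot x < pi Bot c)%N) t x.
  by move=> tC; apply: (cvg_big add_continuous) => x _; exact: near_in_coord.
have lftB t c : Op t -> lft (D t) Bot c = \sum_(x | (pi Bot x < pi Bot c)%N) t x.
  move=> tO; have [rz lt _ _] := reg t tO.
  rewrite -(realizes_gcrit rz (lt Bot c)) Fcrit //; apply: eq_bigl => x.
  by have := datum_range Bot c pd; case: (pi Bot c) => // n _; rewrite subn1 ltnS.
have rgtB t c : Op t -> rgt (D t) Bot c = lft (D t) Bot c + t c.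
  move=> tO; have [rz lt tl last] := reg t tO; have [_ t1] := tO.
  (* This sum is the next critical value, or 1 for the last letter. *)
  have E : \sum_(x | (pi Bot x < (pi Bot c).+1)%N) t x = lft (D t) Bot c + t c.
    rewrite lftB // (bigD1 c) ?ltnS //= addrC; congr (_ + _); apply: eq_bigl => x.
    by rewrite ltnS -(inj_eq (datum_inj (e := Bot) pd)) andbC -ltn_neqAle.
  rewrite -E; have := datum_range Bot c pd => /andP[_].
  rewrite leq_eqVlt => /orP[/eqP cA|cA].
    rewrite last // -t1; apply: eq_bigl => x; rewrite cA ltnS.
    by have /andP[_ ->] := datum_range Bot x pd.
  have [b hb] := datum_surj Bot pd (i := (pi Bot c).+1) cA.
  by rewrite (tile_next tl hb) lftB // hb.
exists D; split.
- split=> // t x e c tC.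
  have ab := arcs t c tC.
  apply: (@levy_cvg _ _ _ _ (fun t' => brn (D t') e c) _ (brn (D t) (other e) c)).
  + exact: (arc_homo ab e).
  + exact: (arc_homo ab (other e)).
  + exact: (arcK ab e).
  + by move=> y; have := arcK ab (other e) y; rewrite otherK.
  move=> eps eps0; have eps2 : 0 < eps / 2 by rewrite divr_gt0.
  apply: filterS (near_arcs t (eps / 2) tC eps2) => t' [t'C /(_ c)[n1 n2]] y.
  have E : 2 * (eps / 2) = eps by rewrite mulrC divfK.
  have := levy_le ab (arcs t' c t'C) n1 n2 e y.
  by have := levy_le (arcs t' c t'C) ab n2 n1 e y; rewrite E.
- exact: rgtC.
- move=> t tC; split.
  + move=> e c; exact: (arc_le_side (arcs t c tC)).
  + move=> e c c' cc'; apply: (eq_on_closure tC (rgtC t e c tC) (lftC t e c' tC)) => x xO.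
    by have [_ _ tl _] := reg x xO; exact: (tile_next tl cc').
  + move=> e c c1; apply: (eq_on_closure (g' := fun=> 0) tC (lftC t e c tC) (cvg_cst _)) => x xO.
    by have [_ _ tl _] := reg x xO; exact: (tile_first tl c1).
  + move=> e c c' h h'; apply: (eq_on_closure tC (rgtC t e c tC) (rgtC t _ c' tC)) => x xO.
    by have [_ _ tl _] := reg x xO; exact: (tile_last tl h h').
- move=> t tC; split=> e c.
  + exact: (arc_homo (arcs t c tC)).
  + exact: (arcK (arcs t c tC)).
  + exact: (arc_lft (arcs t c tC)).
  + exact: (arc_rgt (arcs t c tC)).
- move=> t e c tC h; apply: (eq_on_closure (g' := fun=> 1) tC (rgtC t e c tC) (cvg_cst _)) => x xO.
  by have [_ _ _ last] := reg x xO; exact: last.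
- move=> t c tC.
  apply: (eq_on_closure (g := fun t => rgt (D t) Bot c - lft (D t) Bot c) (g' := fun t => t c) tC).
  + by apply: cvgB; [exact: rgtC|exact: lftC].
  + exact: near_in_coord.
  + by move=> x xO; rewrite rgtB // addrC addKr.
- by move=> t tO; have [] := reg t tO.
Qed.

End Family.

(** * Pulling back marked partitions *)

Lemma telescope_ord (V : zmodType) (N : nat) (g : int -> V) (a b : int) :
  0 <= a -> a <= b -> b <= N%:Z ->
  \sum_(j < N | a <= j%:Z < b) (g (j%:Z + 1) - g j%:Z) = g b - g a.
Proof.
case: a => // a _; case: b => // b; rewrite !lez_nat => ab bN.
rewrite -(@telescope_sumr _ a b (fun j => g j%:Z)) // big_geq_mkord.
rewrite (big_ord_widen_cond N (fun j => a <= j)%N (fun j => g j.+1%:Z - g j%:Z)) //.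
by apply: eq_big => [j|j _]; rewrite ?lez_nat // -addn1 PoszD.
Qed.

Lemma tile_total (A : finType) (V : realDomainType) (pi : datum A) (D : branches A V) e w :
  is_datum pi -> tiled pi D -> pi e w = #|A| ->
  \sum_x (rgt D e x - lft D e x) = rgt D e w.
Proof.
move=> pd tD ew; rewrite (bigD1 w) //= addrC.
have -> : \sum_(x | x != w) (rgt D e x - lft D e x) = lft D e w.
  rewrite (tile_sum e w pd tD); apply: eq_bigl => x.
  rewrite ew ltn_neqAle -ew (inj_eq (datum_inj pd)).
  by have /andP[_ h] := datum_range e x pd; rewrite ew h andbT.
by rewrite subrKC.
Qed.

Section PullBack.
Variables (R : realType) (A : finType) (pi : datum A) (F : (A -> R) -> giet R A).
Variable D : (A -> R) -> branches A R.
Hypotheses (pd : is_datum pi) (A0 : (0 < #|A|)%N) (fD : branch_family pi F D).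
Variable lam : A -> nat.
Let J := int_iet pi lam.
Let N := (\sum_c lam c)%N.
Let ClI := @closed_simplex R 'I_N.
Let Cl := @closed_simplex R A.

Let tJ : tiled pi J. Proof. exact: int_iet_tiled. Qed.
Let bJ : branched J. Proof. exact: (translating_branched (int_iet_translating pi lam)). Qed.

(** The position of the integer [x] when the unit intervals of [0, N] receive
    the lengths [u], extended by constants on either side. *)
Definition mark (u : 'I_N -> R) (x : int) : R := \sum_(j < N | j%:Z < x) u j.

Lemma mark_le u : ClI u -> {homo mark u : x y / x <= y}.
Proof.
move=> [u0 _] x y xy; rewrite /mark [leRHS]big_mkcond [leLHS]big_mkcond /=.
apply: ler_sum => j _; case: ifP => [jx|_]; first by rewrite (lt_le_trans jx xy).
by case: ifP.
Qed.

Lemma mark0 u : mark u 0 = 0.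
Proof. by rewrite /mark big_pred0. Qed.

Lemma markN u : ClI u -> mark u N%:Z = 1.
Proof. by move=> [_ <-]; apply: eq_bigl => j; rewrite ltz_nat ltn_ord. Qed.

Lemma mark_sub u a b : a <= b -> mark u b - mark u a = \sum_(j < N | a <= j%:Z < b) u j.
Proof.
move=> ab; rewrite /mark (bigID (fun j : 'I_N => j%:Z < a)) /=.
rewrite (eq_bigl (fun j : 'I_N => j%:Z < a)); last first.
  by move=> j; case: (ltP j%:Z a) => ja; rewrite ?andbF // (lt_le_trans ja ab).
rewrite addrAC subrr add0r; apply: eq_bigl => j.
by rewrite -leNgt andbC.
Qed.

Lemma mark_cvg u x : mark u' x @[u' --> near_in ClI u] --> mark u x.
Proof. by apply: (cvg_big add_continuous) => j _; exact: near_in_coord. Qed.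

Definition marked_branches u : branches A R :=
  Branches (fun e c => mark u (lft J e c)) (fun e c => mark u (rgt J e c)) (fun _ _ => id).

Lemma marked_tiled u : ClI u -> tiled pi (marked_branches u).
Proof.
move=> uC; split=> /= [e c|e c c' cc'|e c c1|e c c' h h'].
- by apply: mark_le => //; exact: (tile_le tJ).
- by congr mark; exact: (tile_next tJ).
- by rewrite -[RHS](mark0 u); congr mark; exact: (tile_first tJ).
- by congr mark; exact: (tile_last tJ).
Qed.

(** The parameter for which the bottom intervals of the branches are the
    images by [mark u] of those of [J]. *)
Definition marked_params u c : R := mark u (rgt J Bot c) - mark u (lft J Bot c).

Lemma marked_params_simplex u : ClI u -> Cl (marked_params u).
Proof.
move=> uC; split=> [c|]; first by rewrite subr_ge0; apply: mark_le => //; exact: (tile_le tJ).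
have [b hb] := datum_surj Bot pd (i := #|A|) (introT andP (conj A0 (leqnn _))).
rewrite (tile_total pd (marked_tiled uC) hb) /=.
rewrite -(markN uC); congr mark; exact: int_iet_rgt.
Qed.

Lemma marked_params_cvg u : ClI u ->
  marked_params u' @[u' --> near_in ClI u] `=>` near_in Cl (marked_params u).
Proof.
move=> uC; apply: cvg_near_in => [|c].
  by apply: filterS (near_in_dom ClI u) => v; exact: marked_params_simplex.
by apply: cvgB; exact: mark_cvg.
Qed.

Lemma lft_same_lengths e (B B' : branches A R) : tiled pi B -> tiled pi B' ->
  (forall c, rgt B e c - lft B e c = rgt B' e c - lft B' e c) ->
  forall c, lft B e c = lft B' e c /\ rgt B e c = rgt B' e c.
Proof.
move=> tB tB' h c.
have E : lft B e c = lft B' e c.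
  by rewrite (tile_sum e c pd tB) (tile_sum e c pd tB'); apply: eq_bigr => x _.
by split=> //; have := h c; rewrite E => /(congr1 (fun z => z + lft B' e c)); rewrite !subrK.
Qed.

Lemma family_bot_marks u c : ClI u ->
  lft (D (marked_params u)) Bot c = mark u (lft J Bot c) /\
  rgt (D (marked_params u)) Bot c = mark u (rgt J Bot c).
Proof.
move=> uC; have tC := marked_params_simplex uC.
apply: (lft_same_lengths (bf_tiled fD tC) (marked_tiled uC)) => x.
by rewrite (bf_bot fD).
Qed.

(** The point that the branch of [c] sends to the mark of the image of [x]
    under [J]. *)
Definition pulled_mark u c (x : int) : R :=
  brn (D (marked_params u)) Bot c (mark u (brn J Top c x)).

(** The length of the preimage of the piece to which [J] sends the [j]-th unit
    interval. The top intervals of [J] are disjoint, so at most one term of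
    the sum is nonzero. *)
Definition pull_back u (j : 'I_N) : R :=
  \sum_c if lft J Top c <= j%:Z < rgt J Top c
         then pulled_mark u c (j%:Z + 1) - pulled_mark u c j%:Z else 0.

Lemma pulled_mark_ends u c : ClI u ->
  pulled_mark u c (lft J Top c) = lft (D (marked_params u)) Top c /\
  pulled_mark u c (rgt J Top c) = rgt (D (marked_params u)) Top c.
Proof.
move=> uC; have bD := bf_branched fD (marked_params_simplex uC).
have [l r] := family_bot_marks c uC.
rewrite /pulled_mark (brn_lft bJ) (brn_rgt bJ) -[other Top]/Bot -l -r.
by rewrite (brn_lft bD) (brn_rgt bD).
Qed.

Let J_itv c : 0 <= lft J Top c /\ rgt J Top c <= N%:Z.
Proof.
split; first exact: (tile_lft_ge0 _ _ pd tJ).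
have [b hb] := datum_surj Top pd (i := #|A|) (introT andP (conj A0 (leqnn _))).
by rewrite -(int_iet_rgt lam pd hb); exact: (tile_rgt_le _ pd tJ hb).
Qed.

(** Over a top interval of [J] the new lengths telescope to the length of the
    top interval of the branch, and these lengths add up to one. *)
Lemma pull_back_simplex u : ClI u -> ClI (pull_back u).
Proof.
move=> uC; have tC := marked_params_simplex uC; have bD := bf_branched fD tC.
split=> [j|].
  apply: sumr_ge0 => c _; case: ifP => // _; rewrite subr_ge0.
  apply: (brn_le bD); apply: mark_le => //; apply: (brn_le bJ); lia.
rewrite exchange_big /=.
transitivity (\sum_c (rgt (D (marked_params u)) Top c - lft (D (marked_params u)) Top c)).
  apply: eq_bigr => c _; rewrite -big_mkcond; have [l r] := J_itv c.
  rewrite telescope_ord //; last exact: (tile_le tJ).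
  by have [-> ->] := pulled_mark_ends c uC.
have [b hb] := datum_surj Top pd (i := #|A|) (introT andP (conj A0 (leqnn _))).
by rewrite (tile_total pd (bf_tiled fD tC) hb) (bf_last fD).
Qed.

Lemma pulled_mark_cvg u c x : ClI u ->
  pulled_mark u' c x @[u' --> near_in ClI u] --> pulled_mark u c x.
Proof.
move=> uC; have tC := marked_params_simplex uC.
have hp := cvg_pair (marked_params_cvg uC) (@mark_cvg u (brn J Top c x)).
have hc := cb_brn (bf_continuous fD) (x := mark u (brn J Top c x)) (e := Bot) (c := c) tC.
exact: (cvg_comp _ _ (hp _ _ _) hc).
Qed.

Lemma pull_back_cvg u j : ClI u ->
  pull_back u' j @[u' --> near_in ClI u] --> pull_back u j.
Proof.
move=> uC; apply: (cvg_big add_continuous) => c _.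
by case: ifP => _; [apply: cvgB; exact: pulled_mark_cvg|exact: cvg_cst].
Qed.

(** At a fixed point the marks and the pulled-back marks have the same
    increments on each top interval of [J]. The top intervals of the branches
    therefore have the lengths prescribed by the marks, so they are in the
    prescribed places, and the marks coincide with the pulled-back ones. *)
Lemma fixed_intertwines u : ClI u -> (forall j, pull_back u j = u j) ->
  intertwines (mark u) J (D (marked_params u)).
Proof.
move=> uC fu; have tC := marked_params_simplex uC; have bD := bf_branched fD tC.
have step c x : lft J Top c <= x <= rgt J Top c ->
    mark u x - mark u (lft J Top c) = pulled_mark u c x - pulled_mark u c (lft J Top c).
  move=> /andP[lx xr]; rewrite mark_sub //; have [l r] := J_itv c.
  rewrite -(@telescope_ord _ N) //; last exact: le_trans r.
  apply: eq_bigr => j /andP[lj jx]; rewrite -fu /pull_back (bigD1 c) //= lj (lt_le_trans jx xr) /=.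
  rewrite big1 ?addr0 // => c' c'c; case: ifP => // /andP[l' r'].
  have : pi Top c' != pi Top c by rewrite (inj_eq (datum_inj pd)).
  rewrite neq_ltn => /orP[lt|lt].
    by have := tile_order pd tJ lt; rewrite leNgt (le_lt_trans lj r').
  by have := tile_order pd tJ lt; rewrite leNgt (le_lt_trans l') // (lt_le_trans jx).
have tops c := lft_same_lengths (e := Top) (marked_tiled uC) (bf_tiled fD tC) _ c.
have {}tops c : mark u (lft J Top c) = lft (D (marked_params u)) Top c /\
    mark u (rgt J Top c) = rgt (D (marked_params u)) Top c.
  apply: tops => b /=; rewrite step ?lexx ?(tile_le tJ) //.
  by have [-> ->] := pulled_mark_ends b uC.
have markE c x : lft J Top c <= x <= rgt J Top c -> mark u x = pulled_mark u c x.
  move=> xc; have := step c x xc; have [-> _] := pulled_mark_ends c uC.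
  by have [-> _] := tops c => /addIr.
split.
  case=> c; last exact: family_bot_marks.
  by have [-> ->] := tops c.
case=> c x xc; first by rewrite (markE c x xc) /pulled_mark (brnK bD Bot).
have yc := brn_itv bJ xc.
by rewrite [RHS](markE c _ yc) /pulled_mark (brnK bJ Bot).
Qed.

Lemma exists_intertwined (N0 : (0 < N)%N) : exists2 t, Cl t &
  exists2 X, {homo X : x y / x <= y} & intertwines X J (D t).
Proof.
have [u uC fu] := @simplex_fixed_point R 'I_N (Ordinal N0) pull_back
  pull_back_simplex pull_back_cvg.
exists (marked_params u); first exact: marked_params_simplex.
by exists (mark u); [exact: mark_le|exact: fixed_intertwines].
Qed.

End PullBack.

(** * Rauzy induction of a map with given branches *)

Section FirstReturn.
Variables (R : realType) (J : set R) (f : R -> R) (x : R).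

Lemma first_return_once : J (f x) -> first_return J f x = f x.
Proof.
move=> Jx; rewrite /first_return; case: pselect => [ex|[]]; last by exists 1%N; rewrite /= inE.
case: ex_minnP => m /andP[m0 _] hm.
have : (m <= 1)%N by apply: hm; rewrite /= inE.
by case: m m0 {hm} => [|[|m]].
Qed.

Lemma first_return_twice : ~ J (f x) -> J (f (f x)) -> first_return J f x = f (f x).
Proof.
move=> nJ Jx; rewrite /first_return; case: pselect => [ex|[]]; last by exists 2%N; rewrite /= inE.
case: ex_minnP => m /andP[m0 Jm] hm.
have : (m <= 2)%N by apply: hm; rewrite /= inE.
by case: m m0 Jm {hm} => [|[|[|m]]] //= _; rewrite inE.
Qed.

End FirstReturn.

Lemma brn_itvco (A : finType) (V : realDomainType) (D : branches A V) s c x :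
  branched D -> lft D s c <= x < rgt D s c ->
  lft D (other s) c <= brn D s c x < rgt D (other s) c.
Proof.
by move=> bD; rewrite -(brn_lft bD) -(brn_rgt bD) (brn_le_mono _ _ bD) (brn_lt_mono _ _ bD).
Qed.

Section RealizedStep.
Variables (R : realType) (A : finType) (pi : datum A) (e : side) (w l : A).
Variables (b : R) (f : giet R A) (D : branches A R).
Hypotheses (pd : is_datum pi) (win : last_letter pi e = Some w)
  (lose : last_letter pi (other e) = Some l) (wl : w != l).
Hypotheses (tD : tiled pi D) (bD : branched D) (rf : realizes pi b f D).
Hypothesis lft_rgt : forall e c, lft D e c < rgt D e c.
Hypothesis lt_wl : lft D e w < lft D (other e) l.
Hypothesis end_b : rgt D e w = b.

Let lst : rgt D e w = rgt D (other e) l. Proof. exact: last_ends win lose tD. Qed.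

Lemma realizes_last_crit s c : last_letter pi s = Some c -> last_crit f s = lft D s c.
Proof.
move=> h; rewrite /last_crit (realizes_datum rf) h.
exact: (realizes_gcrit rf (lft_rgt s c)).
Qed.

Lemma realizes_rauzy_type : rauzy_type f = e.
Proof.
have ew := realizes_last_crit win; have el := realizes_last_crit lose.
by move: lt_wl ew el; rewrite /rauzy_type; case: e => /= lt -> ->; rewrite ?lt // ltNge (ltW lt).
Qed.

Lemma realizes_renormalizable : renormalizable f.
Proof.
have ew := realizes_last_crit win; have el := realizes_last_crit lose.
rewrite /renormalizable; move: lt_wl ew el; case: e => /= lt -> -> E;
by move: lt; rewrite E ltxx.
Qed.

Lemma rgt_le_last s c a : last_letter pi s = Some a -> c != a -> rgt D s c <= lft D s a.
Proof.
move=> /last_letterP ha ca; apply: (tile_order pd tD).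
rewrite ha ltn_neqAle -ha (inj_eq (datum_inj pd)) ca ha.
by have /andP[] := datum_range s c pd.
Qed.

Let D' := rauzy_step e w l D.

(** Only the points of the new interval of the loser leave the shortened
    interval; they come back at once, and their second iterate is the value of
    the composed branch. *)
Lemma step_first_return c x : lft D' Top c <= x < rgt D' Top c ->
  first_return [set` `[0, lft D (other e) l[] (gmap f) x = brn D' Top c x.
Proof.
have ge0 s d : 0 <= lft D s d by exact: (tile_lft_ge0 _ _ pd tD).
have fE d y : lft D Top d <= y < rgt D Top d -> gmap f y = brn D Top d y.
  by move=> /andP[]; exact: (realizes_map rf).
have lw : (l == w) = false by rewrite eq_sym (negbTE wl).
have leL s d : last_letter pi s = Some l -> d != l -> rgt D s d <= lft D s l.
  exact: rgt_le_last.
have leW s d : last_letter pi s = Some w -> d != w -> rgt D s d <= lft D s w.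
  exact: rgt_le_last.
have cutE := lft_cut bD (ltW lt_wl); have cutE' := cut_rgt win lose tD bD.
move: win lose lt_wl lst cutE cutE'; rewrite /D'; case: e => /= win' lose' lt ls cw1 cw2.
  have [->|cl] := eqVneq c l.
    rewrite lw => xl; have yl := brn_itvco bD xl; have /andP[y1 y2] := yl.
    have yw : lft D Top w <= brn D Top l x < rgt D Top w.
      by rewrite ls y2 (le_trans (ltW lt) y1).
    have /andP[z1 z2] := brn_itvco bD yw.
    have out : ~ [set` `[0, lft D Bot l[] (gmap f x).
      by rewrite (fE l) //= in_itv /= [_ < lft D Bot l]ltNge y1 andbF.
    have back : [set` `[0, lft D Bot l[] (gmap f (gmap f x)).
      rewrite (fE l x xl) (fE w _ yw) /= in_itv /= (le_trans (ge0 _ _) z1) (lt_le_trans z2) //.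
      exact: leL.
    by rewrite (first_return_twice out back) (fE l x xl) (fE w _ yw).
  move=> xc; have {xc} xc : lft D Top c <= x < rgt D Top c.
    move: xc; have [->|//] := eqVneq c w; move=> /andP[-> x2] /=.
    by rewrite ls (lt_trans x2) ?lft_rgt.
  have /andP[y1 y2] := brn_itvco bD xc.
  have back : [set` `[0, lft D Bot l[] (gmap f x).
    by rewrite (fE c x xc) /= in_itv /= (le_trans (ge0 _ _) y1) (lt_le_trans y2) // leL.
  by rewrite (first_return_once back) (fE c x xc).
have [->|cl] := eqVneq c l.
  rewrite lw => /andP[x1 x2]; have xw : lft D Top w <= x < rgt D Top w.
    by rewrite (le_trans cw1 x1) x2.
  have y1 : lft D Top l <= brn D Top w x.
    by rewrite -(brnK bD Bot w (lft D Top l)) (brn_le_mono _ _ bD).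
  have /andP[_ y2] := brn_itvco bD xw.
  have yl : lft D Top l <= brn D Top w x < rgt D Top l by rewrite y1 -ls.
  have /andP[z1 z2] := brn_itvco bD yl.
  have out : ~ [set` `[0, lft D Top l[] (gmap f x).
    by rewrite (fE w x xw) /= in_itv /= [_ < lft D Top l]ltNge y1 andbF.
  have back : [set` `[0, lft D Top l[] (gmap f (gmap f x)).
    rewrite (fE w x xw) (fE l _ yl) /= in_itv /= (le_trans (ge0 _ _) z1) (lt_le_trans z2) //.
    by rewrite (le_trans (leW _ _ win' _) (ltW lt)) // eq_sym.
  by rewrite (first_return_twice out back) (fE w x xw) (fE l _ yl).
have [->|cw] := eqVneq c w.
  move=> /andP[x1 x2]; have xw : lft D Top w <= x < rgt D Top w.
    by rewrite x1 (lt_le_trans x2).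
  have /andP[y1 _] := brn_itvco bD xw.
  have back : [set` `[0, lft D Top l[] (gmap f x).
    rewrite (fE w x xw) /= in_itv /= (le_trans (ge0 _ _) y1) /=.
    by rewrite -(brnK bD Bot w (lft D Top l)) (brn_lt_mono _ _ bD).
  by rewrite (first_return_once back) (fE w x xw).
move=> xc; have /andP[y1 y2] := brn_itvco bD xc.
have back : [set` `[0, lft D Top l[] (gmap f x).
  rewrite (fE c x xc) /= in_itv /= (le_trans (ge0 _ _) y1) (lt_le_trans y2) //.
  by rewrite (le_trans (leW _ _ win' cw) (ltW lt)).
by rewrite (first_return_once back) (fE c x xc).
Qed.

(** The two descriptions of the new top intervals in the definition of the
    Rauzy induction are intervals with the endpoints produced by the step. *)
Lemma step_top_itv c :
  (match e with
   | Top => if c == w then gint f Top w `\` gint f Bot l else gint f Top c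
   | Bot => if c == l then gdom f `&` gmap f @^-1` gint f Top l
            else if c == w then gint f Top w `\` (gdom f `&` gmap f @^-1` gint f Top l)
            else gint f Top c
   end) = [set` `[lft D' Top c, rgt D' Top c[].
Proof.
have ge0 s d : 0 <= lft D s d by exact: (tile_lft_ge0 _ _ pd tD).
have fE d y : lft D Top d <= y < rgt D Top d -> gmap f y = brn D Top d y.
  by move=> /andP[]; exact: (realizes_map rf).
have lw : (l == w) = false by rewrite eq_sym (negbTE wl).
have leW s d : last_letter pi s = Some w -> d != w -> rgt D s d <= lft D s w.
  exact: rgt_le_last.
have cutE := lft_cut bD (ltW lt_wl); have cutE' := cut_rgt win lose tD bD.
move: win lose lt_wl lst end_b cutE cutE'; rewrite /D' !(realizes_int rf).
case: e => /= win' lose' lt ls eb cw1 cw2.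
  have [->|cw] := eqVneq c w; last by [].
  apply/seteqP; split=> x /=; rewrite !in_itv /= ?ls.
    by move=> [/andP[-> x2]]; rewrite x2 andbT leNgt => /negP/negPn.
  move=> /andP[-> x2]; split; first by rewrite (lt_trans x2) ?lft_rgt.
  by rewrite leNgt x2.
(* The preimage of the interval of the loser lies in the interval of w: the
   other bottom intervals end before the interval of the loser begins. *)
have preE : gdom f `&` gmap f @^-1` [set` `[lft D Top l, rgt D Top l[]
    = [set` `[cut_point Bot w l D, rgt D Top w[].
  apply/seteqP; split=> x /=; rewrite /gdom (realizes_lo rf) (realizes_hi rf) /= !in_itv /=.
    move=> [/andP[x0 xb] /andP[h1 h2]].
    have xl : x < rgt D Top l by rewrite -ls eb.
    have [d xd] := tile_cover pd tD (last_letterP lose') x0 xl.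
    have /andP[y1 y2] := brn_itvco bD xd; rewrite (fE d) // in h1 h2.
    have [dw|dw] := eqVneq d w; last first.
      have := lt_trans (le_lt_trans h1 y2) (le_lt_trans (leW _ _ win' dw) lt).
      by rewrite ltxx.
    subst d; move: xd => /andP[_ ->]; rewrite andbT /cut_point.
    by rewrite -(brnK bD Top w x) (brn_le_mono _ _ bD).
  move=> /andP[x1 x2]; have xw : lft D Top w <= x < rgt D Top w.
    by rewrite x2 (le_trans cw1 x1).
  have /andP[_ y2] := brn_itvco bD xw.
  rewrite (fE w) // -ls y2 (le_trans (ge0 _ _) (le_trans cw1 x1)) (lt_le_trans x2) //=; last first.
    by rewrite -eb ls; exact: (tile_rgt_le _ pd tD (last_letterP lose')).
  by rewrite -(brnK bD Bot w (lft D Top l)) (brn_le_mono _ _ bD) x1.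
have [->|cl] := eqVneq c l; first by rewrite lw.
have [->|cw] := eqVneq c w; last by [].
rewrite preE; apply/seteqP; split=> x /=; rewrite !in_itv /=.
  by move=> [/andP[-> ->]]; rewrite andbT leNgt => /negP/negPn.
move=> /andP[-> x2]; rewrite (lt_le_trans x2 cw2); split=> //.
by rewrite leNgt x2.
Qed.

Lemma realizes_rauzy_induction :
  realizes (rauzy_op e pi) (lft D (other e) l) (rauzy_induction f) D'.
Proof.
have fpi := realizes_datum rf.
have [at_ [ab [hat hab hmax hit]]] : exists at_ ab,
    [/\ last_letter pi Top = Some at_, last_letter pi Bot = Some ab,
        Num.max (lft D Top at_) (lft D Bot ab) = lft D (other e) l
      & forall c, (match rauzy_type f with
      | Top => if c == at_ then gint f Top at_ `\` gint f Bot ab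
               else gint f Top c
      | Bot => if c == at_ then gdom f `&` gmap f @^-1` gint f Top at_
               else if c == ab then gint f Top ab `\` (gdom f `&` gmap f @^-1` gint f Top at_)
               else gint f Top c
      end) = [set` `[lft D' Top c, rgt D' Top c[]].
  have := step_top_itv; rewrite realizes_rauzy_type; move: win lose lt_wl.
  case: (e) => /= win' lose' lt hh.
    by exists w, l; split=> //; rewrite max_r // ltW.
  by exists l, w; split=> //; rewrite max_l // ltW.
rewrite /rauzy_induction fpi hat hab (realizes_last_crit hat) (realizes_last_crit hab) hmax.
rewrite (realizes_lo rf).
have bD' : branched D' by exact: (rauzy_step_branched win lose wl tD bD).
have retE c x : lft D' Top c <= x < rgt D' Top c ->
  first_return [set` `[0, lft D (other e) l[] (gmap f) x = brn D' Top c x.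
  exact: step_first_return.
split=> //=.
- by rewrite realizes_rauzy_type.
- case=> c; rewrite hit //.
  apply/seteqP; split=> y /=.
    move=> [x]; rewrite /= !in_itv /= => xc <-.
    by rewrite (retE c) //; exact: (brn_itvco bD' xc).
  rewrite in_itv /= => yc; have xc := brn_itvco (s := Bot) bD' yc.
  by exists (brn D' Bot c y); rewrite /= ?in_itv // (retE c) // (brnK bD' Bot).
- by move=> c x h1 h2; apply: retE; rewrite h1.
Qed.

End RealizedStep.

(** * Following a Rauzy path in a full family *)

(** The new endpoints and branches are obtained from the old ones by
    composition. *)
Lemma rauzy_step_continuous (R : realType) (A : finType) e w l
    (D : (A -> R) -> branches A R) : continuous_branches D ->
  continuous_branches (fun t => rauzy_step e w l (D t)).
Proof.
move=> cD.
have brnT (T : Type) (G : set_system T) (FG : Filter G) (u : T -> A -> R) (x : T -> R) t y s c :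
    closed_simplex t -> u z @[z --> G] `=>` near_in (@closed_simplex R A) t ->
    x z @[z --> G] --> y ->
    brn (D (u z)) s c (x z) @[z --> G] --> brn (D t) s c y.
  move=> tC cu cx; have hp := cvg_pair (cu : u z @[z --> G] --> near_in (@closed_simplex R A) t) cx.
  exact: (cvg_comp _ _ (hp _ _ _) (cb_brn cD (x := y) (e := s) (c := c) tC)).
split=> [t s c tC|t x s c tC] /=.
  case: ifP => _; last exact: (cb_lft cD).
  by apply: brnT => //; exact: (cb_lft cD).
have c1 : z.1 @[z --> (near_in (@closed_simplex R A) t, nbhs x)]
    `=>` near_in (@closed_simplex R A) t.
  exact: cvg_fst.
have c2 : z.2 @[z --> (near_in (@closed_simplex R A) t, nbhs x)] --> x by exact: cvg_snd.
case: ifP => _; last exact: (cb_brn cD).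
by case: ifP => _ /=; apply: (brnT) => //; apply: brnT.
Qed.

(** If the same letter were last on both sides, the first #|A| - 1 positions
    would hold the same letters. *)
Lemma admissible_last_neq (A : finType) (pi : datum A) e w l : (2 <= #|A|)%N ->
  is_datum pi -> admissible pi ->
  last_letter pi e = Some w -> last_letter pi (other e) = Some l -> w != l.
Proof.
move=> hA pd adm win lose; apply/eqP => wl; subst l.
have [wT wB] : pi Top w = #|A| /\ pi Bot w = #|A|.
  by case: e win lose => /last_letterP h /last_letterP h'.
apply: (adm (#|A| - 1)%N); first by rewrite leqnn andbT subn_gt0.
have E s : pi s w = #|A| -> pi s @^-1` [set i | (1 <= i <= #|A| - 1)%N] = [set c | c != w].
  move=> sw; apply/seteqP; split=> c /=.
    by move=> /andP[_ h]; apply: contraTneq h => ->; rewrite sw -ltnNge subn1 prednK // ltnW.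
  move=> cw; have /andP[-> h] := datum_range s c pd.
  rewrite subn1 -ltnS prednK ?(ltnW hA) // ltn_neqAle h andbT -sw.
  by rewrite (inj_eq (datum_inj pd)).
by rewrite !E.
Qed.

Lemma gdatum_rauzy_induction (R : realType) (A : finType) (f : giet R A) :
  gdatum (rauzy_induction f) = rauzy_op (rauzy_type f) (gdatum f).
Proof.
rewrite /rauzy_induction /rauzy_op.
case E1: (last_letter (gdatum f) Top) => [a|]; case E2: (last_letter (gdatum f) Bot) => [b|];
  by case: (rauzy_type f) => /=; rewrite ?E1 ?E2.
Qed.

Lemma tile_end (A : finType) (V : realDomainType) (pi : datum A) (D : branches A V) s c s' c' :
  is_datum pi -> tiled pi D -> pi s c = #|A| -> pi s' c' = #|A| -> rgt D s c = rgt D s' c'.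
Proof.
move=> pd tD; have [->|/neq_other->] := eqVneq s' s; last exact: (tile_last tD).
by move=> h h'; congr rgt; apply: (datum_inj (e := s) pd); rewrite h.
Qed.

Section RealizeWalk.
Variables (R : realType) (A : finType) (hA : (2 <= #|A|)%N) (pi : datum A).
Variables (P : nat -> datum A) (e : nat -> side) (w l : nat -> A).
Hypotheses (walk : rauzy_walk P e w l) (P0 : P 0%N = pi).
Hypothesis wins : forall c n, exists2 k, (n <= k)%N & w k = c.
Variable F : (A -> R) -> giet R A.
Hypothesis F_full : full_family pi F.

Let pd : is_datum pi. Proof. by rewrite -P0; exact: (walk_datum walk). Qed.
Let A0 : (0 < #|A|)%N. Proof. exact: ltnW. Qed.

(** The integer exchange of [backward_lengths] follows the walk for [n] steps,
    and a fixed point of the pull-back transports its inequalities to the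
    branches of the family. *)
Lemma exists_weakly_following D n : branch_family pi F D ->
  exists2 t, closed_simplex t & weakly_follows e w l (D t) n.
Proof.
move=> fD; have [lam [lam0 hlam]] := backward_lengths w l n.
have N0 : (0 < \sum_c lam 0%N c)%N.
  have /card_gt0P[c _] := A0.
  by rewrite (bigD1 c) //= addn_gt0 lam0.
have [t tC [X X_le hX]] := exists_intertwined pd A0 fD N0.
exists t => //.
have tJ : tiled (P 0) (int_iet pi (lam 0%N)) by rewrite P0; exact: int_iet_tiled.
have hJ := int_iet_translating pi (lam 0%N).
apply: (intertwines_follows walk X_le tJ (translating_branched hJ) _ hX).
exact: (translating_follows walk tJ hJ hlam).
Qed.

(** A cluster point of parameters that follow longer and longer parts of the
    walk follows all of it weakly, hence strictly since no letter is
    degenerate. *)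
Theorem full_family_realizes : exists t, [/\ open_simplex t,
  forall k, renormalizable (iter k (@rauzy_induction R A) (F t)) &
  forall k, rauzy_path (F t) k = (P k, e k)].
Proof.
have [D fD] := full_family_branches pd F_full.
have cD k : continuous_branches (fun t => renormalize e w l (D t) k).
  by elim: k => [|k IHk] /=; [exact: bf_continuous fD|exact: rauzy_step_continuous].
have /choice[u hu] : forall n, exists t, closed_simplex t /\ weakly_follows e w l (D t) n.
  by move=> n; have [t tC ft] := exists_weakly_following n fD; exists t.
have [t tC clt] := simplex_cluster (fun n => (hu n).1).
have ft n : weakly_follows e w l (D t) n.
  move=> k kn; rewrite leNgt; apply/negP => lt.
  pose g s c t' := lft (renormalize e w l (D t') k) s c.
  have gC s c : g s c t' @[t' --> near_in (@closed_simplex R A) t] --> g s c t.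
    exact: (cb_lft (cD k)).
  have e0 : 0 < (g (e k) (w k) t - g (other (e k)) (l k) t) / 2 by rewrite divr_gt0 // subr_gt0.
  have /cvgrPdist_lt/(_ _ e0) n1 := gC (e k) (w k).
  have /cvgrPdist_lt/(_ _ e0) n2 := gC (other (e k)) (l k).
  have [m km [/= h1 h2]] := clt _ (filterI n1 n2) k.+1.
  have := (hu m).2 k km; rewrite -/(g (e k) (w k) (u m)) -/(g (other (e k)) (l k) (u m)).
  by move: h1 h2; rewrite !ltr_norml; lra.
have tD : tiled (P 0) (D t) by rewrite P0; exact: (bf_tiled fD).
have bD := bf_branched fD tC.
(* The lengths of the top intervals add up to one. *)
have nondeg : exists c, lft (D t) Top c != rgt (D t) Top c.
  have [b hb] := datum_surj Top pd (i := #|A|) (introT andP (conj A0 (leqnn _))).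
  have := tile_total pd (bf_tiled fD tC) hb; rewrite (bf_last fD tC hb).
  move=> E; apply: contrapT => nex; move: E; rewrite big1 => [/eqP|c _].
    by rewrite eq_sym oner_eq0.
  apply/eqP; rewrite subr_eq0 eq_sym; apply: contraT => ne.
  by exfalso; apply: nex; exists c.
have lenk := renormalize_lt walk tD bD ft wins nondeg.
have strict := strictly_follows walk tD bD ft wins nondeg.
have tO : open_simplex t.
  split=> [c|]; last by have [] := tC.
  by rewrite -(bf_bot fD c tC) subr_gt0; exact: (lenk 0%N).
have rk k : exists2 b, realizes (P k) b (iter k (@rauzy_induction R A) (F t))
      (renormalize e w l (D t) k)
    & rgt (renormalize e w l (D t) k) (e k) (w k) = b.
  elim: k => [|k [b rb eb]].
    exists 1; first by rewrite P0; exact: (bf_realizes fD).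
    by apply: (bf_last fD tC); rewrite -P0; exact: last_letterP (walk_win walk 0).
  have [tk bk] := renormalize_tiled walk tD bD (ft k) (leqnn k).
  have [tk' bk'] := renormalize_tiled walk tD bD (ft k.+1) (leqnn k.+1).
  have := realizes_rauzy_induction (walk_datum walk k) (walk_win walk k) (walk_lose walk k)
    (walk_neq walk k) tk bk rb (lenk k) (strict k) eb.
  rewrite -(walk_next walk) => rk'; eexists; first exact: rk'.
  rewrite (tile_end (s' := e k) (c' := w k) (walk_datum walk k.+1) tk') /= ?eqxx //.
    exact: last_letterP (walk_win walk k.+1).
  rewrite (walk_next walk) (rauzy_opE (walk_win walk k) (walk_lose walk k)) eqxx.
  exact: last_letterP (walk_win walk k).
exists t; split=> // k; have [b rb eb] := rk k.
  by apply: (realizes_renormalizable (walk_win walk k) (walk_lose walk k) rb (lenk k) (strict k)).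
rewrite /rauzy_path (realizes_datum rb).
by rewrite (realizes_rauzy_type (walk_win walk k) (walk_lose walk k) rb (lenk k) (strict k)).
Qed.

End RealizeWalk.

Theorem theorem1p5 (R : realType) (A : finType) (hA : (2 <= #|A|)%N)
    (pi : datum A) (pi_datum : is_datum pi) (pi_adm : admissible pi)
    (C : set (datum A)) (C_class : rauzy_class C) (C_pi : C pi)
    (pi_star : datum A) (C_star : C pi_star) (star_cyclic : cyclic_datum pi_star)
    (F : (A -> R) -> giet R A) (F_full : full_family pi F)
    (T : giet R A) (T_keane : keane_iet pi 0 1 T) :
  exists t : A -> R,
    [/\ open_simplex t,
        infinitely_renormalizable (F t)
      & rauzy_path (F t) = rauzy_path T].
Proof.
have [[[_ [T_pi _ _] _ _ _] _] [_ T_wins]] := T_keane.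
have [_ C_ok C_inv _] := C_class.
pose Tk k := iter k (@rauzy_induction R A) T.
pose P k := gdatum (Tk k); pose e k := rauzy_type (Tk k).
have P_next k : P k.+1 = rauzy_op (e k) (P k) by exact: gdatum_rauzy_induction.
have CP k : C (P k).
  elim: k => [|k IHk]; first by rewrite /P /= T_pi.
  by rewrite P_next; exact: C_inv.
have last_ex k s : exists c, last_letter (P k) s = Some c.
  have [Pd _] := C_ok _ (CP k).
  have [c hc] := datum_surj s Pd (i := #|A|) (introT andP (conj (ltnW hA) (leqnn _))).
  by exists c; exact: last_letter_some.
have /choice[w win] := fun k => last_ex k (e k).
have /choice[l lose] := fun k => last_ex k (other (e k)).
have walk : rauzy_walk P e w l.
  split=> // k; have [Pd Padm] := C_ok _ (CP k); first by [].
  exact: (admissible_last_neq hA Pd Padm (win k) (lose k)).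
have wins c n : exists2 k, (n <= k)%N & w k = c.
  have [k nk wk] := T_wins c n; exists k => //.
  by move: wk; rewrite /winner /= -/(Tk k) win => -[].
have [t [tO ren path]] := full_family_realizes hA walk T_pi wins F_full.
have pathE : rauzy_path (F t) = rauzy_path T by apply/funext => k; rewrite path.
by exists t; split=> //; split=> //; rewrite pathE.
Qed.
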